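(* (b) A bivariant vectorial FQ operation $\Xi$ is uniquely determined by its circular-basis coefficients $\tilde p^{[s]}_{4,\dots,4}$ ($s\in\{1,2\}$, all numbers of indices $\ge0$, the empty word giving the constant term), and these can be prescribed arbitrarily (i.e. for any choice of these real numbers there is exactly one bivariant vectorial FQ operation with these coefficients). (b') The same holds for antivariant vectorial FQ operations with the coefficients $\tilde p^{[s]}_{5,\dots,5}$, $s\in\{1,2\}$. (c) The same holds for left-variant scalar (resp. pseudoscalar) FQ operations with the coefficients $\tilde p^{[0]}_{4,\dots,4}$ (resp. $\tilde p^{[12]}_{4,\dots,4}$). (c') The same holds for right-variant scalar (resp. pseudoscalar) FQ operations with the coefficients $\tilde p^{[0]}_{5,\dots,5}$ (resp. $\tilde p^{[12]}_{5,\dots,5}$).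
   Context: Setting. $(Q_1,Q_2)$ is a Clifford system: $Q_1^2=Q_2^2=-1$, $Q_1Q_2=-Q_2Q_1$. $R_1,R_2$ are formal noncommuting infinitesimal variables; one works in the real algebra generated by $Q_1,Q_2,R_1,R_2$ (free apart from the Clifford relations), completed with respect to total degree in $R_1,R_2$, or in extensions of it by further formal infinitesimal elements. Put $A_i=Q_i+R_i$. For $Q$ with $Q^2=-1$ and any $X$ put $X^0_Q=\frac12(X+Q^{-1}XQ)$, $X^1_Q=\frac12(X-Q^{-1}XQ)$. The split variables are $r_1,\dots,r_8$: for $j\in\{1,2\}$, $\iota_1,\iota_2\in\{0,1\}$, $r_{4(j-1)+2\iota_1+\iota_2+1}=((R_jQ_j^{-1})^{\iota_1}_{Q_1})^{\iota_2}_{Q_2}$. An FQ operation around $(Q_1,Q_2)$ is given by formal real noncommutative power series in eight variables: scalar $\Xi(A_1,A_2)=f_0(r_1,\dots,r_8)$, vectorial $\Xi(A_1,A_2)=(f_1(r)Q_1,f_2(r)Q_2)$, pseudoscalar $\Xi(A_1,A_2)=f_{12}(r)Q_1Q_2$; the operation is identified with this family of series. The same series can be evaluated at any pair $(A'_1,A'_2)$ with $A'_i-Q_i$ infinitesimal, by forming the split variables of $A'_i-Q_i$. Mixed basis: $\hat r_1=\frac12(r_2-r_7)$, $\hat r_2=\frac12(r_2+r_7)$, $\hat r_3=\frac12(r_1+r_5)$, $\hat r_4=\frac12(r_1-r_5)$, $\hat r_5=\frac12(r_4-r_8)$, $\hat r_6=\frac12(r_4+r_8)$, $\hat r_7=\frac12(r_3+r_6)$,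 $\hat r_8=\frac12(r_3-r_6)$. Circular basis: $\tilde r_i=\hat r_i$ for $i\notin\{4,5\}$, $\tilde r_4=\hat r_4+\hat r_5$, $\tilde r_5=\hat r_4-\hat r_5$; $\tilde p^{[s]}_{i_1,\dots,i_r}$ is the coefficient of $\tilde r_{i_1}\cdots\tilde r_{i_r}$ in $f_s$ rewritten in these variables. Variance properties: below $\theta_1,\theta_2$ range over elements of the form $1+\epsilon$ with $\epsilon$ a formal infinitesimal (possibly in an extension algebra), and $\Xi$ is always evaluated around the fixed base $(Q_1,Q_2)$; in the vectorial case the right-hand sides are meant componentwise. $\Xi$ is bivariant if $\Xi(\theta_1A_1\theta_2,\theta_1A_2\theta_2)=\theta_1\Xi(A_1,A_2)\theta_2$; antivariant if $\Xi(\theta_1A_1\theta_2,\theta_1A_2\theta_2)=\theta_2^{-1}\Xi(A_1,A_2)\theta_1^{-1}$; left-variant if $\Xi(\theta_1A_1\theta_2,\theta_1A_2\theta_2)=\theta_1\Xi(A_1,A_2)\theta_1^{-1}$; right-variant if $\Xi(\theta_1A_1\theta_2,\theta_1A_2\theta_2)=\theta_2^{-1}\Xi(A_1,A_2)\theta_2$. *)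

(* Defs.v *)
(* Concrete model of the completed real algebra generated by
   a Clifford system (Q1,Q2) and free noncommuting infinitesimals. *)
From mathcomp Require Import all_boot all_order all_algebra.
Set Implicit Arguments. Unset Strict Implicit. Unset Printing Implicit Defensive.
Import GRing.Theory Num.Theory.
Local Open Scope ring_scope.

(* The algebra.  A "letter" (j, a, b) is the split component
   ((Y_j)^a_{Q1})^b_{Q2} of a free generator Y_j (j < n): it commutes with Q1
   if a = false and anticommutes with Q1 if a = true; likewise b for Q2.
   An element is a formal (possibly infinite) sum
       sum_{c,d,u} x c d u * Q1^c Q2^d * u     (u a word in letters),
   i.e. a function  bool -> bool -> seq letter -> R.  Degree = length of u. *)
Definition letter (n : nat) := ('I_n * bool * bool)%type.
Definition elt (R : fieldType) (n : nat) := bool -> bool -> seq (letter n) -> R.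

Section Algebra.
Variables (R : fieldType) (n : nat).

Definition sgn (b : bool) : R := if b then -1 else 1.

Definition par1 (u : seq (letter n)) : bool := foldr (fun l b => l.1.2 (+) b) false u.
Definition par2 (u : seq (letter n)) : bool := foldr (fun l b => l.2 (+) b) false u.

Definition ezero : elt R n := fun _ _ _ => 0.
Definition eadd (x y : elt R n) : elt R n := fun c d u => x c d u + y c d u.
Definition eopp (x : elt R n) : elt R n := fun c d u => - x c d u.
Definition esub (x y : elt R n) : elt R n := eadd x (eopp y).
Definition escale (k : R) (x : elt R n) : elt R n := fun c d u => k * x c d u.

Definition ebasis (c0 d0 : bool) : elt R n :=
  fun c d u => if [&& c == c0, d == d0 & u == [::]] then 1 else 0.
Definition eone : elt R n := ebasis false false.
Definition eQ1 : elt R n := ebasis true false.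
Definition eQ2 : elt R n := ebasis false true.
Definition eQ12 : elt R n := ebasis true true.

Definition eletter (y : letter n) : elt R n :=
  fun c d u => if [&& ~~ c, ~~ d & u == [:: y]] then 1 else 0.

(* multiplication:  (Q1^c1 Q2^d1 v)(Q1^c2 Q2^d2 w)
     = (-1)^(d1 c2 + c1 c2 + d1 d2 + par1 v c2 + par2 v d2) Q1^(c1+c2) Q2^(d1+d2) v w *)
Definition emul (x y : elt R n) : elt R n :=
  fun c d u =>
    \sum_(i < (size u).+1) \sum_(c1 : bool) \sum_(d1 : bool)
      let c2 := c1 (+) c in let d2 := d1 (+) d in
      let v := take i u in let w := drop i u in
      sgn ((d1 && c2) (+) (c1 && c2) (+) (d1 && d2)
               (+) (par1 v && c2) (+) (par2 v && d2))
      * x c1 d1 v * y c2 d2 w.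

Definition epow (x : elt R n) (k : nat) : elt R n := iter k (emul x) eone.
Definition eprod (s : seq (elt R n)) : elt R n := foldr emul eone s.

Definition infinitesimal (x : elt R n) : Prop := forall c d, x c d [::] = 0.

(* inverse of 1 + eps (eps infinitesimal) as the geometric series, truncated
   coefficientwise (terms of degree > size u do not contribute at u) *)
Definition uinv (eps : elt R n) : elt R n :=
  fun c d u => \sum_(k < (size u).+1) epow (eopp eps) k c d u.

(* Q^{-1} = -Q since Q^2 = -1 *)
Definition Qinv (Q : elt R n) : elt R n := eopp Q.

Definition qsplit (Q : elt R n) (b : bool) (X : elt R n) : elt R n :=
  escale 2^-1 (eadd X (escale (sgn b) (emul (emul (Qinv Q) X) Q))).

Definition Qj (j : bool) : elt R n := if j then eQ2 else eQ1.

(* split variables r_1..r_8 (0-based index k = 4(j-1) + 2 iota1 + iota2)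
   of the pair (A1', A2') around (Q1,Q2) *)
Definition splitvars (A1 A2 : elt R n) (k : 'I_8) : elt R n :=
  let j := (3 < k)%N in
  let i1 := odd (k %/ 2) in
  let i2 := odd k in
  let X := esub (if j then A2 else A1) (Qj j) in
  qsplit eQ2 i2 (qsplit eQ1 i1 (emul X (Qinv (Qj j)))).

End Algebra.

(* formal real noncommutative power series in 8 variables r_1..r_8
   (variable r_{k+1} is the ordinal k) *)
Definition series (R : fieldType) := seq 'I_8 -> R.

Definition seval (R : fieldType) (n : nat) (f : series R) (xs : 'I_8 -> elt R n)
  : elt R n :=
  fun c d u => \sum_(k < (size u).+1) \sum_(t : k.-tuple 'I_8)
                 f t * eprod (map xs t) c d u.

(* The generic arguments.  In the algebra with n = m.+2 free generators,
   generators 0 and 1 give R_1, R_2 (the remaining m are further formal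
   infinitesimals):  R_j := (sum of the four split letters of j) * Q_j, so that
   R_j Q_j^{-1} has these letters as split components.  A_j = Q_j + R_j. *)
Section Generic.
Variables (R : fieldType) (m : nat).
Definition gen (j : bool) : 'I_m.+2 := inord (nat_of_bool j).
Definition Rgen (j : bool) : elt R m.+2 :=
  emul (eadd (eadd (@eletter R _ (gen j, false, false)) (@eletter R _ (gen j, false, true)))
             (eadd (@eletter R _ (gen j, true, false)) (@eletter R _ (gen j, true, true))))
       (@Qj R m.+2 j).
Definition Agen (j : bool) : elt R m.+2 := eadd (@Qj R m.+2 j) (Rgen j).

Definition Xi_scalar (f0 : series R) (A1 A2 : elt R m.+2) : elt R m.+2 :=
  seval f0 (splitvars A1 A2).
Definition Xi_pseudo (f12 : series R) (A1 A2 : elt R m.+2) : elt R m.+2 :=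
  emul (seval f12 (splitvars A1 A2)) (@eQ12 R m.+2).
Definition Xi_vec (F : series R * series R) (j : bool) (A1 A2 : elt R m.+2)
  : elt R m.+2 :=
  emul (seval (if j then F.2 else F.1) (splitvars A1 A2)) (@Qj R m.+2 j).

Definition twist (e1 e2 : elt R m.+2) (A : elt R m.+2) : elt R m.+2 :=
  emul (emul (eadd (@eone R _) e1) A) (eadd (@eone R _) e2).
End Generic.

(* Variance properties (theta_i = 1 + eps_i, eps_i arbitrary infinitesimal
   elements of any extension by finitely many further formal infinitesimals). *)
Definition variance_prop (R : fieldType)
  (Xi : forall m, elt R m.+2 -> elt R m.+2 -> elt R m.+2)
  (rhs : forall m, elt R m.+2 -> elt R m.+2 -> elt R m.+2 -> elt R m.+2) : Prop :=
  forall (m : nat) (e1 e2 : elt R m.+2),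
    infinitesimal e1 -> infinitesimal e2 ->
    Xi m (twist e1 e2 (@Agen R m false)) (twist e1 e2 (@Agen R m true))
    = rhs m e1 e2 (Xi m (@Agen R m false) (@Agen R m true)).

Section Variances.
Variable R : fieldType.
Definition th (m : nat) (e : elt R m.+2) := eadd (@eone R _) e.
Definition rhs_bi m (e1 e2 X : elt R m.+2) := emul (emul (th e1) X) (th e2).
Definition rhs_anti m (e1 e2 X : elt R m.+2) := emul (emul (uinv e2) X) (uinv e1).
Definition rhs_left m (e1 e2 X : elt R m.+2) := emul (emul (th e1) X) (uinv e1).
Definition rhs_right m (e1 e2 X : elt R m.+2) := emul (emul (uinv e2) X) (th e2).

Definition vec_variant (rhs : forall m, elt R m.+2 -> elt R m.+2 -> elt R m.+2 -> elt R m.+2)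
  (F : series R * series R) : Prop :=
  forall j : bool, variance_prop (fun m => @Xi_vec R m F j) rhs.

Definition bivariant_vec := vec_variant rhs_bi.
Definition antivariant_vec := vec_variant rhs_anti.
Definition leftvariant_scalar (f : series R) := variance_prop (fun m => @Xi_scalar R m f) rhs_left.
Definition leftvariant_pseudo (f : series R) := variance_prop (fun m => @Xi_pseudo R m f) rhs_left.
Definition rightvariant_scalar (f : series R) := variance_prop (fun m => @Xi_scalar R m f) rhs_right.
Definition rightvariant_pseudo (f : series R) := variance_prop (fun m => @Xi_pseudo R m f) rhs_right.
End Variances.

(* Mixed and circular bases.  hatM: rhat = hatM r ; circN: rtilde = circN rhat
   (0-based indices). *)
Definition hatM (R : fieldType) : 'M[R]_8 :=
  \matrix_(i < 8, j < 8)
   match nat_of_ord i, nat_of_ord j with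
   | 0, 1 => 2^-1 | 0, 6 => - 2^-1
   | 1, 1 => 2^-1 | 1, 6 => 2^-1
   | 2, 0 => 2^-1 | 2, 4 => 2^-1
   | 3, 0 => 2^-1 | 3, 4 => - 2^-1
   | 4, 3 => 2^-1 | 4, 7 => - 2^-1
   | 5, 3 => 2^-1 | 5, 7 => 2^-1
   | 6, 2 => 2^-1 | 6, 5 => 2^-1
   | 7, 2 => 2^-1 | 7, 5 => - 2^-1
   | _, _ => 0
   end.

Definition circN (R : fieldType) : 'M[R]_8 :=
  \matrix_(i < 8, j < 8)
   match nat_of_ord i, nat_of_ord j with
   | 3, 3 => 1 | 3, 4 => 1
   | 4, 3 => 1 | 4, 4 => -1
   | i, j => if (i == j)%N then 1 else 0
   end.

Definition Lc (R : fieldType) : 'M[R]_8 := invmx (circN R *m hatM R).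

(* coefficient of the word rtilde_{t_1} ... rtilde_{t_k} in f rewritten in
   the circular variables (substitution r_j := sum_l Lc j l rtilde_l) *)
Definition circ_coef (R : fieldType) (f : series R) (t : seq 'I_8) : R :=
  \sum_(w : (size t).-tuple 'I_8)
     f w * \prod_(i < size t) Lc R (tnth w i) (nth ord0 t i).

(* rtilde_4 and rtilde_5 as 0-based ordinals *)
Definition i4 : 'I_8 := @Ordinal 8 3 isT.
Definition i5 : 'I_8 := @Ordinal 8 4 isT.

(* Main.v *)
(* A pair (A1, A2) is moved by (theta1, theta2) so that B := A2 A1^-1 becomes
   theta1 B theta1^-1; at the base point B = Q1 Q2, and T := 1 + B^2 is an
   infinitesimal with linear part 4 rtilde_4 (conjugating by Q1 turns rtilde_4
   into rtilde_5).

   Uniqueness: theta1 := 1 + T commutes with B, so together with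
   theta2 := A1^-1 theta1^-1 A1 it fixes (A1, A2).  Variance then says that the
   operation, multiplied by suitable powers of A1 on both sides, commutes with T.
   Hence the lowest-degree part of its series commutes with the free variable
   rtilde_4 (resp. rtilde_5), so it is a multiple of a power of that variable.

   Existence: A1^-p T^k A_j A1^-s has the required variance, and its leading term
   is a nonzero multiple of rtilde_4^k (resp. rtilde_5^k); a triangular system
   yields arbitrary coefficients.  That this expression is given by a universal
   series holds because evaluation of series at split variables extends to a
   ring homomorphism sending the generic pair to the given pair. *)
Require Import Defs.
From HB Require Import structures.
From mathcomp Require Import all_boot all_order all_algebra.
From mathcomp Require Import boolp ring zify.
Set Implicit Arguments. Unset Strict Implicit. Unset Printing Implicit Defensive.
Import GRing.Theory Num.Theory.
Local Open Scope ring_scope.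

(** * The ring structure *)

Section EltRing.
Variables (R : fieldType) (n : nat).
Implicit Types (x y z : elt R n) (a : letter n) (u : seq (letter n)).

Lemma eltP x y : (forall c d u, x c d u = y c d u) <-> x = y.
Proof.
split=> [h|-> //]; apply/funext=> c; apply/funext=> d; apply/funext=> u; exact: h.
Qed.

Lemma sgnD (b1 b2 : bool) : sgn R (b1 (+) b2) = sgn R b1 * sgn R b2.
Proof. by case: b1; case: b2; rewrite /sgn /= ?(mulN1r, mul1r, opprK, mulr1). Qed.

(** The sign picked up when the letter [a] moves across [Q1^c Q2^d]. *)
Definition asgn a (c d : bool) : R := sgn R ((a.1.2 && c) (+) (a.2 && d)).

Definition csgn (c1 d1 c2 d2 : bool) : R :=
  sgn R ((d1 && c2) (+) (c1 && c2) (+) (d1 && d2)).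

(** Left division by [a]: each element is its constant part plus the sum of [a * lderiv a x] over
    all letters. The sign comes from moving [a] to the front. *)
Definition lderiv a x : elt R n := fun c d u => asgn a c d * x c d (a :: u).

(** Carries the constant part [x0] of [x] across a letter: [x0 * a = a * const_twist a x]. *)
Definition const_twist a x : elt R n :=
  fun c d u => if u is [::] then asgn a c d * x c d [::] else 0.

Lemma emul_nil x y c d : emul x y c d [::] =
  \sum_(c1 : bool) \sum_(d1 : bool)
    csgn c1 d1 (c1 (+) c) (d1 (+) d) * x c1 d1 [::] * y (c1 (+) c) (d1 (+) d) [::].
Proof.
by rewrite /emul big_ord1; apply: eq_bigr=> c1 _; apply: eq_bigr=> d1 _;
   rewrite /= !addbF.
Qed.

Lemma emul_const x y c d u : (forall c d u, u != [::] -> x c d u = 0) ->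
  emul x y c d u =
  \sum_(c1 : bool) \sum_(d1 : bool)
    csgn c1 d1 (c1 (+) c) (d1 (+) d) * x c1 d1 [::] * y (c1 (+) c) (d1 (+) d) u.
Proof.
move=> x0; rewrite /emul big_ord_recl [X in _ + X]big1 => [|i _].
  rewrite addr0; apply: eq_bigr=> c1 _; apply: eq_bigr=> d1 _.
  by rewrite /= take0 drop0 /= !addbF.
apply: big1=> c1 _; apply: big1=> d1 _; rewrite x0 ?mulr0 ?mul0r //=.
by case: u i => // [[]].
Qed.

Lemma const_twist_const a x c d u : u != [::] -> const_twist a x c d u = 0.
Proof. by case: u. Qed.

(* The Leibniz rule characterises the product by recursion on words. *)
Lemma emul_cons x y c d a u : emul x y c d (a :: u) =
  asgn a c d * (emul (const_twist a x) (lderiv a y) c d u + emul (lderiv a x) y c d u).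
Proof.
rewrite mulrDr (emul_const _ _ _ _ (@const_twist_const a x)) {1}/emul big_ord_recl.
congr (_ + _).
  rewrite mulr_sumr; apply: eq_bigr=> c1 _; rewrite mulr_sumr; apply: eq_bigr=> d1 _.
  rewrite /lderiv /const_twist /asgn /csgn /= !addbF.
  rewrite -!mulrA [in RHS](mulrCA (x _ _ _)) !mulrA -!sgnD; congr (sgn _ _ * _ * _).
  by case: (a.1.2); case: (a.2); case: c1; case: d1; case: c; case: d.
rewrite /emul mulr_sumr; apply: eq_bigr=> i _.
rewrite mulr_sumr; apply: eq_bigr=> c1 _; rewrite mulr_sumr; apply: eq_bigr=> d1 _ /=.
rewrite /lderiv /asgn !mulrA -!sgnD; congr (sgn _ _ * _ * _).
by move: (par1 _) (par2 _); case: (a.1.2); case: (a.2); case: c1; case: d1;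
  case: c; case: d=> [] [] [].
Qed.

Lemma eaddA : associative (@eadd R n).
Proof. by move=> x y z; apply/eltP=> c d u; rewrite /eadd addrA. Qed.
Lemma eaddC : commutative (@eadd R n).
Proof. by move=> x y; apply/eltP=> c d u; rewrite /eadd addrC. Qed.
Lemma eadd0 : left_id (@ezero R n) (@eadd R n).
Proof. by move=> x; apply/eltP=> c d u; rewrite /eadd add0r. Qed.
Lemma eaddN : left_inverse (@ezero R n) (@eopp R n) (@eadd R n).
Proof. by move=> x; apply/eltP=> c d u; rewrite /eadd addNr. Qed.

Lemma emulDl : left_distributive (@emul R n) (@eadd R n).
Proof.
move=> x y z; apply/eltP=> c d u; rewrite /eadd /emul -big_split.
apply: eq_bigr=> i _; rewrite -big_split; apply: eq_bigr=> c1 _.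
by rewrite -big_split; apply: eq_bigr=> d1 _ /=; rewrite mulrDr mulrDl.
Qed.

Lemma emulDr : right_distributive (@emul R n) (@eadd R n).
Proof.
move=> x y z; apply/eltP=> c d u; rewrite /eadd /emul -big_split.
apply: eq_bigr=> i _; rewrite -big_split; apply: eq_bigr=> c1 _.
by rewrite -big_split; apply: eq_bigr=> d1 _ /=; rewrite mulrDr.
Qed.

Lemma escaleAl k x y : escale k (emul x y) = emul (escale k x) y.
Proof.
apply/eltP=> c d u; rewrite /escale /emul mulr_sumr.
apply: eq_bigr=> i _; rewrite mulr_sumr; apply: eq_bigr=> c1 _.
by rewrite mulr_sumr; apply: eq_bigr=> d1 _ /=; rewrite !mulrA (mulrC k).
Qed.

Lemma escaleAr k x y : escale k (emul x y) = emul x (escale k y).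
Proof.
apply/eltP=> c d u; rewrite /escale /emul mulr_sumr.
apply: eq_bigr=> i _; rewrite mulr_sumr; apply: eq_bigr=> c1 _.
by rewrite mulr_sumr; apply: eq_bigr=> d1 _ /=; rewrite mulrCA.
Qed.

Lemma lderivM a x y :
  lderiv a (emul x y) = eadd (emul (const_twist a x) (lderiv a y)) (emul (lderiv a x) y).
Proof.
apply/eltP=> c d u; rewrite {1}/lderiv emul_cons mulrA -/(eadd _ _ _ _ _).
by rewrite /asgn -sgnD addbb mul1r.
Qed.

Lemma const_twistM a x y :
  const_twist a (emul x y) = emul (const_twist a x) (const_twist a y).
Proof.
apply/eltP=> c d u; rewrite (emul_const _ _ _ _ (@const_twist_const a x)).
rewrite /const_twist; case: u=> [|b u]; last first.
  by rewrite big1 // => c1 _; rewrite big1 // => d1 _; rewrite mulr0.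
rewrite emul_nil mulr_sumr; apply: eq_bigr=> c1 _; rewrite mulr_sumr; apply: eq_bigr=> d1 _.
rewrite -!mulrA [in RHS](mulrCA (x _ _ _)) !mulrA /asgn /csgn -!sgnD.
congr (sgn _ _ * _ * _).
by case: (a.1.2); case: (a.2); case: c1; case: d1; case: c; case: d.
Qed.

(** The Leibniz rule reduces a word to its tail, so induction on the word leaves only the constant
    terms. *)
Lemma emulA : associative (@emul R n).
Proof.
move=> x y z; apply/eltP=> c d u; elim: u x y z => [|a u IH] x y z; last first.
  rewrite !emul_cons !lderivM !const_twistM emulDl emulDr /eadd.
  by rewrite -!IH addrA.
(* Empty word: associativity of the Clifford algebra itself, checked on signs. *)
rewrite !emul_nil !big_bool /= !emul_nil !big_bool /=.
by rewrite /csgn /sgn; case: c; case: d => /=; ring.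
Qed.

Lemma ebasis_const c0 d0 c d u : u != [::] -> @ebasis R n c0 d0 c d u = 0.
Proof. by rewrite /ebasis => /negbTE ->; rewrite !andbF. Qed.

Lemma ebasisMl c0 d0 x c d u :
  emul (@ebasis R n c0 d0) x c d u =
  csgn c0 d0 (c0 (+) c) (d0 (+) d) * x (c0 (+) c) (d0 (+) d) u.
Proof.
rewrite (emul_const _ _ _ _ (@ebasis_const c0 d0)) !big_bool /ebasis.
by case: c0; case: d0; rewrite /= ?(mulr0, mulr1, mul0r, addr0, add0r).
Qed.

Lemma ebasisMr c0 d0 x c d u :
  emul x (@ebasis R n c0 d0) c d u =
  csgn (c (+) c0) (d (+) d0) c0 d0 * sgn R ((par1 u && c0) (+) (par2 u && d0))
   * x (c (+) c0) (d (+) d0) u.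
Proof.
rewrite /emul big_ord_recr /= [X in X + _]big1 => [|i _]; last first.
  apply: big1=> c1 _; apply: big1=> d1 _; rewrite ebasis_const ?mulr0 //.
  by rewrite -size_eq0 size_drop subn_eq0 -ltnNge /=.
rewrite take_size drop_size add0r !big_bool /ebasis /csgn -sgnD !addbA.
by case: c0; case: d0; case: c; case: d; rewrite /= ?(mulr0, mulr1, mul0r, addr0, add0r).
Qed.

Lemma emul1 : left_id (@eone R n) (@emul R n).
Proof. by move=> x; apply/eltP=> c d u; rewrite ebasisMl mul1r. Qed.

Lemma emulr1 : right_id (@eone R n) (@emul R n).
Proof.
move=> x; apply/eltP=> c d u.
by rewrite ebasisMr /csgn !andbF /= !mul1r !addbF.
Qed.

Lemma eone_neq0 : @eone R n <> @ezero R n.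
Proof.
move=> /eltP /(_ false false [::]); rewrite /eone /ebasis /ezero /=.
by apply/eqP; rewrite oner_neq0.
Qed.

End EltRing.

HB.instance Definition _ (R : fieldType) n := gen_eqMixin (elt R n).
HB.instance Definition _ (R : fieldType) n := gen_choiceMixin (elt R n).
HB.instance Definition _ (R : fieldType) n :=
  GRing.isZmodule.Build (elt R n) (@eaddA R n) (@eaddC R n) (@eadd0 R n) (@eaddN R n).
Fact eone_neqb0 (R : fieldType) n : @eone R n != 0 :> elt R n.
Proof. by apply/eqP; exact: eone_neq0. Qed.
HB.instance Definition _ (R : fieldType) n :=
  GRing.Zmodule_isNzRing.Build (elt R n) (@emulA R n) (@emul1 R n) (@emulr1 R n)
    (@emulDl R n) (@emulDr R n) (@eone_neqb0 R n).

Section EltLmod.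
Variables (R : fieldType) (n : nat).
Lemma escaleA (k l : R) (x : elt R n) : escale k (escale l x) = escale (k * l) x.
Proof. by apply/eltP=> c d u; rewrite /escale mulrA. Qed.
Lemma escale1 : left_id 1 (@escale R n).
Proof. by move=> x; apply/eltP=> c d u; rewrite /escale mul1r. Qed.
Lemma escaleDr : right_distributive (@escale R n) +%R.
Proof. by move=> k x y; apply/eltP=> c d u; rewrite /escale mulrDr. Qed.
Lemma escaleDl (x : elt R n) : {morph (@escale R n)^~ x : k l / k + l}.
Proof. by move=> k l; apply/eltP=> c d u; rewrite /escale mulrDl. Qed.
End EltLmod.
HB.instance Definition _ (R : fieldType) n :=
  GRing.Zmodule_isLmodule.Build R (elt R n) (@escaleA R n) (@escale1 R n)
    (@escaleDr R n) (@escaleDl R n).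
HB.instance Definition _ (R : fieldType) n :=
  GRing.Lmodule_isLalgebra.Build R (elt R n) (@escaleAl R n).
HB.instance Definition _ (R : fieldType) n :=
  GRing.Lalgebra_isAlgebra.Build R (elt R n) (@escaleAr R n).

(** * Degree filtration and evaluation of series *)

Section Degree.
Variables (R : fieldType) (n : nat).
Implicit Types (x y z e : elt R n) (N : nat).

Lemma coefD x y c d u : (x + y) c d u = x c d u + y c d u. Proof. by []. Qed.
Lemma coefN x c d u : (- x) c d u = - x c d u. Proof. by []. Qed.
Lemma coefB x y c d u : (x - y) c d u = x c d u - y c d u. Proof. by []. Qed.
Lemma coefZ (k : R) x c d u : (k *: x) c d u = k * x c d u. Proof. by []. Qed.
Lemma coef_sum I (r : seq I) (P : pred I) (F : I -> elt R n) c d u :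
  (\sum_(i <- r | P i) F i) c d u = \sum_(i <- r | P i) F i c d u.
Proof. by elim/big_rec2: _ => // i a b _ <-. Qed.

Lemma elt_opsE :
  (@eadd R n = +%R) * (@eopp R n = -%R) * (@emul R n = *%R) *
  (@escale R n = *:%R) * (@eone R n = 1).
Proof. by []. Qed.

Lemma coef1 c d u : (1 : elt R n) c d u = ([&& ~~ c, ~~ d & u == [::]])%:R.
Proof. by rewrite -[1]/(@eone R n) /eone /ebasis !eqbF_neg; case: ifP. Qed.

Definition deg_ge N x := forall c d u, (size u < N)%N -> x c d u = 0.

Lemma deg_geW M N x : (M <= N)%N -> deg_ge N x -> deg_ge M x.
Proof. by move=> le_MN hx c d u ltu; apply: hx; apply: leq_trans ltu le_MN. Qed.

Lemma deg_geD N x y : deg_ge N x -> deg_ge N y -> deg_ge N (x + y).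
Proof. by move=> hx hy c d u ltu; rewrite coefD hx ?hy ?addr0. Qed.

Lemma deg_geN N x : deg_ge N x -> deg_ge N (- x).
Proof. by move=> hx c d u ltu; rewrite coefN hx ?oppr0. Qed.

Lemma deg_geB N x y : deg_ge N x -> deg_ge N y -> deg_ge N (x - y).
Proof. by move=> hx hy; apply/deg_geD => //; apply/deg_geN. Qed.

Lemma deg_geZ N (k : R) x : deg_ge N x -> deg_ge N (k *: x).
Proof. by move=> hx c d u ltu; rewrite coefZ hx ?mulr0. Qed.

Lemma deg_ge_sum N I (r : seq I) (P : pred I) (F : I -> elt R n) :
  (forall i, P i -> deg_ge N (F i)) -> deg_ge N (\sum_(i <- r | P i) F i).
Proof. by move=> hF; elim/big_ind: _ => //; apply: deg_geD. Qed.

Lemma deg_geM M N x y : deg_ge M x -> deg_ge N y -> deg_ge (M + N) (x * y).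
Proof.
move=> hx hy c d u ltu; rewrite -[x * y]/(emul x y) /emul.
apply: big1 => i _; apply: big1 => c1 _; apply: big1 => d1 _ /=.
have lei : (i <= size u)%N by rewrite -ltnS.
case: (ltnP i M) => hi; first by rewrite hx ?mulr0 ?mul0r // size_takel.
by rewrite hy ?mulr0 // size_drop; lia.
Qed.

Lemma deg_geMl N x y : deg_ge N y -> deg_ge N (x * y).
Proof. exact: (@deg_geM 0). Qed.

Lemma deg_geMr N x y : deg_ge N x -> deg_ge N (x * y).
Proof. by move=> hx; rewrite -[N]addn0; apply: deg_geM. Qed.

Lemma deg_geX N k x : deg_ge N x -> deg_ge (k * N) (x ^+ k).
Proof.
by move=> hx; elim: k => // k IH; rewrite exprS mulSn; apply: deg_geM.
Qed.

Lemma infinitesimalE x : infinitesimal x <-> deg_ge 1 x.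
Proof. by split=> [hx c d [] // _|hx c d]; apply: hx. Qed.

Lemma deg_ge_eq0 x : (forall N, deg_ge N x) -> x = 0.
Proof. by move=> hx; apply/eltP => c d u; apply: (hx (size u).+1). Qed.

(** Congruence modulo degree at least [N]. The filtration is separated ([eqmod_eq]), so identities
    of infinite sums can be proved on truncations. *)
Definition eqmod N x y := deg_ge N (x - y).

Lemma eqmodP N x y :
  eqmod N x y <-> (forall c d u, (size u < N)%N -> x c d u = y c d u).
Proof.
split=> h c d u ltu; last by rewrite coefB h ?subrr.
by apply/eqP; rewrite -subr_eq0 -coefB h.
Qed.

Lemma eqmod_refl N x : eqmod N x x. Proof. by rewrite /eqmod subrr. Qed.
Lemma eqmod_sym N x y : eqmod N x y -> eqmod N y x.
Proof. by rewrite !eqmodP => h c d u ltu; rewrite h. Qed.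
Lemma eqmod_trans N y x z : eqmod N x y -> eqmod N y z -> eqmod N x z.
Proof. by rewrite !eqmodP => h1 h2 c d u ltu; rewrite h1 ?h2. Qed.
Lemma eqmodW M N x y : (M <= N)%N -> eqmod N x y -> eqmod M x y.
Proof. exact: deg_geW. Qed.
Lemma eqmodD N x x' y y' : eqmod N x x' -> eqmod N y y' -> eqmod N (x + y) (x' + y').
Proof. by rewrite !eqmodP => h1 h2 c d u ltu; rewrite !coefD h1 ?h2. Qed.
Lemma eqmod_sum N I (r : seq I) (P : pred I) (F G : I -> elt R n) :
  (forall i, P i -> eqmod N (F i) (G i)) ->
  eqmod N (\sum_(i <- r | P i) F i) (\sum_(i <- r | P i) G i).
Proof.
by move=> h; elim/big_rec2: _ => [|i a b Pi]; [exact: eqmod_refl | apply: eqmodD; apply: h].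
Qed.
(** A factor of degree at least [M] improves the precision by [M]; this isolates leading terms
    later. *)
Lemma eqmodMl N M x y z : deg_ge M x -> eqmod N y z -> eqmod (M + N) (x * y) (x * z).
Proof. by rewrite /eqmod -mulrBr; apply: deg_geM. Qed.
Lemma eqmodMr N M x y z : deg_ge M x -> eqmod N y z -> eqmod (N + M) (y * x) (z * x).
Proof. by rewrite /eqmod -mulrBl => hx hyz; apply: deg_geM. Qed.
Lemma eqmodM N x x' y y' : eqmod N x x' -> eqmod N y y' -> eqmod N (x * y) (x' * y').
Proof.
move=> hx hy; apply: (@eqmod_trans _ (x' * y)); last exact: (@eqmodMl N 0).
by rewrite -[N]addn0; apply: eqmodMr.
Qed.
Lemma eqmod_eq x y : (forall N, eqmod N x y) -> x = y.
Proof. by move=> h; apply/eqP; rewrite -subr_eq0; apply/eqP/deg_ge_eq0. Qed.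

Lemma epowE x k : epow x k = x ^+ k.
Proof. by elim: k => //= k IH; rewrite exprS -IH. Qed.

Lemma uinv_eqmod N e : infinitesimal e -> eqmod N (uinv e) (\sum_(k < N) (- e) ^+ k).
Proof.
move=> /infinitesimalE e1; apply/eqmodP => c d u ltu; rewrite /uinv coef_sum.
rewrite -(subnKC ltu) big_split_ord /= [X in _ = _ + X]big1 ?addr0 => [|i _].
  by apply: eq_bigr => i _; rewrite epowE.
by apply: (deg_geX (deg_geN e1)); rewrite muln1 ltnS leq_addr.
Qed.

Lemma uinv_infinitesimal e : infinitesimal (uinv e - 1).
Proof. by move=> c d; rewrite coefB /uinv big_ord1 /= subrr. Qed.

(** The truncated geometric sum telescopes, with a remainder of degree at least [N]. *)
Lemma uinvr e : infinitesimal e -> (1 + e) * uinv e = 1.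
Proof.
move=> ie; apply: eqmod_eq => N.
apply: (@eqmod_trans _ ((1 + e) * \sum_(k < N) (- e) ^+ k)).
  by apply: (@eqmodMl N 0) => //; apply: uinv_eqmod.
rewrite -[1 + e]opprK mulNr [- (1 + e)]opprD addrC -subrX1 /eqmod.
have := deg_geX (k := N) (deg_geN (iffLR (infinitesimalE _) ie)).
by rewrite muln1 opprB addrAC subrr add0r; apply: deg_geN.
Qed.

(** [uinv e] is again [1] plus an infinitesimal, so it has a right inverse, which must then be
    [1 + e]. *)
Lemma uinvl e : infinitesimal e -> uinv e * (1 + e) = 1.
Proof.
move=> ie; have := uinvr (uinv_infinitesimal e); rewrite addrC subrK => h.
suff -> : 1 + e = uinv (uinv e - 1) by [].
by rewrite -[LHS]mulr1 -[X in _ * X]h mulrA (uinvr ie) mul1r.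
Qed.

End Degree.
Arguments eqmod_trans {R n N} y {x z}.

Section TupleSum.
Variables (T : finType) (V : nmodType).
Lemma sum_tuple0 (F : seq T -> V) : \sum_(t : 0.-tuple T) F t = F [::].
Proof.
rewrite (big_pred1 [tuple]) // => t; by rewrite [t]tuple0 /=; apply/esym/eqP.
Qed.
Lemma sum_tuple_cons k (F : seq T -> V) :
  \sum_(t : k.+1.-tuple T) F t = \sum_(a : T) \sum_(t : k.-tuple T) F (a :: t).
Proof.
rewrite pair_big /= (reindex (fun p : T * k.-tuple T => [tuple of p.1 :: p.2])) //=.
exists (fun t => (thead t, [tuple of behead t])) => [[a t] _|t _] /=.
  by congr (_, _); apply/val_inj.
by rewrite [RHS]tuple_eta; apply/val_inj.
Qed.
End TupleSum.

Section Evaluation.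
Variables (R : fieldType) (n : nat) (xs : 'I_8 -> elt R n).
Implicit Types (f g : series R).

Definition hcomp k f : elt R n := \sum_(t : k.-tuple 'I_8) f t *: eprod (map xs t).

Definition scons f (k : 'I_8) : series R := fun w => f (k :: w).

Lemma hcomp0 f : hcomp 0 f = f [::] *: 1.
Proof. exact: (sum_tuple0 (fun t : seq 'I_8 => f t *: eprod (map xs t))). Qed.

Lemma hcompS k f : hcomp k.+1 f = \sum_a xs a * hcomp k (scons f a).
Proof.
rewrite /hcomp (sum_tuple_cons k (fun t : seq 'I_8 => f t *: eprod (map xs t))).
apply: eq_bigr => a _; rewrite mulr_sumr; apply: eq_bigr => t _.
by rewrite -scalerAr.
Qed.

Hypothesis xs_inf : forall k, infinitesimal (xs k).

Lemma deg_ge_hcomp k f : deg_ge k (hcomp k f).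
Proof.
elim: k f => // k IH f; rewrite hcompS; apply: deg_ge_sum => a _.
by apply: (@deg_geM _ _ 1); [apply/infinitesimalE | apply: IH].
Qed.

Lemma seval_hcomp N f : eqmod N (seval f xs) (\sum_(k < N) hcomp k f).
Proof.
apply/eqmodP => c d u ltu; rewrite /seval coef_sum -(subnKC ltu) big_split_ord /=.
rewrite [X in _ = _ + X]big1 ?addr0 => [|i _].
  by apply: eq_bigr => i _; rewrite /hcomp coef_sum; apply: eq_bigr.
by apply: deg_ge_hcomp; rewrite ltnS leq_addr.
Qed.

(** Grouping words by their first variable gives the recursion behind the inductions on series. *)
Lemma seval_rec f : seval f xs = f [::] *: 1 + \sum_a xs a * seval (scons f a) xs.
Proof.
apply: eqmod_eq => N; apply: (eqmodW (leqnSn N)).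
apply: (eqmod_trans _ (@seval_hcomp N.+1 f)).
rewrite big_ord_recl hcomp0; apply: eqmodD; first exact: eqmod_refl.
under eq_bigr do rewrite hcompS.
rewrite exchange_big; apply: eqmod_sum => a _ /=; rewrite -mulr_sumr.
by apply/eqmod_sym/(@eqmodMl _ _ _ 1); [apply/infinitesimalE | apply: seval_hcomp].
Qed.

Lemma sevalD f g : seval (fun w => f w + g w) xs = seval f xs + seval g xs.
Proof.
apply/eltP => c d u; rewrite coefD /seval -big_split; apply: eq_bigr => k _.
by rewrite -big_split; apply: eq_bigr => t _; rewrite /= mulrDl.
Qed.

Lemma sevalZ (k : R) f : seval (fun w => k * f w) xs = k *: seval f xs.
Proof.
apply/eltP => c d u; rewrite coefZ /seval mulr_sumr; apply: eq_bigr => i _.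
by rewrite mulr_sumr; apply: eq_bigr => t _; rewrite /= mulrA.
Qed.

Lemma seval_eqmod N f g : (forall w, (size w < N)%N -> f w = g w) ->
  eqmod N (seval f xs) (seval g xs).
Proof.
move=> fg; apply/eqmodP => c d u ltu; rewrite /seval; apply: eq_bigr => k _.
apply: eq_bigr => t _; rewrite fg // size_tuple.
by apply: leq_trans ltu; rewrite ltnS -ltnS.
Qed.

End Evaluation.

(** * Substitution homomorphism out of the generic algebra *)

Definition split_letter m (k : 'I_8) : letter m.+2 :=
  (gen m (3 < k)%N, odd (k %/ 2), odd k).

Section Hom.
Variables (R : fieldType) (n : nat) (xs : 'I_8 -> elt R n).
Let lt := split_letter 0.
Implicit Types (X Y : elt R 2).

(** Coefficient of [u * Q1^c Q2^d]: the Clifford factor stands on the right, as in the definition of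
    an FQ operation. *)
Definition rcoef X (c d : bool) (u : seq (letter 2)) : R :=
  sgn R ((par1 u && c) (+) (par2 u && d)) * X c d u.

Definition lift_const X : elt R n := \sum_c \sum_d X c d [::] *: @ebasis R n c d.

Definition rseries X (c d : bool) : series R := fun w => rcoef X c d (map lt w).

Definition ev X : elt R n := \sum_c \sum_d seval (rseries X c d) xs * @ebasis R n c d.

Lemma rseries_cons X c d k : scons (rseries X c d) k = rseries (lderiv (lt k) X) c d.
Proof.
apply/funext => w; rewrite /scons /rseries /rcoef /lderiv /asgn mulrA -sgnD.
by congr (sgn _ _ * _); rewrite /=; move: (par1 _) (par2 _); case: c; case: d;
   case: odd; case: odd => [] [] [].
Qed.

Lemma evD X Y : ev (X + Y) = ev X + ev Y.
Proof.
rewrite /ev -big_split; apply: eq_bigr => c _; rewrite -big_split.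
apply: eq_bigr => d _ /=; rewrite -mulrDl -sevalD; congr (seval _ _ * _).
by apply/funext => w; rewrite /rseries /rcoef coefD mulrDr.
Qed.

Hypothesis xs_inf : forall k, infinitesimal (xs k).
Hypothesis xs_par : forall k c d,
  @ebasis R n c d * xs k = asgn R (lt k) c d *: (xs k * @ebasis R n c d).

Lemma ev_rec X : ev X = lift_const X + \sum_k xs k * ev (lderiv (lt k) X).
Proof.
rewrite /ev /lift_const.
under [X in _ = _ + X]eq_bigr => k _.
  rewrite mulr_sumr; under eq_bigr => c _ do rewrite mulr_sumr.
  over.
rewrite [X in _ = _ + X]exchange_big -big_split; apply: eq_bigr => c _ /=.
rewrite [X in _ = _ + X]exchange_big -big_split; apply: eq_bigr => d _ /=.
rewrite (seval_rec xs_inf) mulrDl -scalerAl mul1r; congr (_ + _).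
  by rewrite /rseries /rcoef /= mul1r.
rewrite mulr_suml; apply: eq_bigr => k _.
by rewrite rseries_cons mulrA.
Qed.

Lemma ev0 : ev 0 = 0.
Proof. by apply: (@addrI _ (ev 0)); rewrite -evD !addr0. Qed.

Lemma ev_const X : (forall c d u, u != [::] -> X c d u = 0) -> ev X = lift_const X.
Proof.
move=> hX; rewrite ev_rec big1 ?addr0 // => k _.
suff -> : lderiv (lt k) X = 0 by rewrite ev0 mulr0.
by apply/eltP => c d u; rewrite /lderiv hX ?mulr0.
Qed.

Lemma lift_constE X c d u : lift_const X c d u = if u is [::] then X c d [::] else 0.
Proof.
rewrite /lift_const !big_bool /= !coefD !coefZ /ebasis.
by case: u; case: c; case: d => *; rewrite /= ?(mulr0, mulr1, addr0, add0r).
Qed.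

Lemma lift_constM X Y : lift_const (X * Y) = lift_const X * lift_const Y.
Proof.
apply/eltP => c d u; rewrite -[lift_const X * _]/(emul _ _) emul_const; last first.
  by move=> {}c {}d [] // *; rewrite lift_constE.
rewrite !lift_constE -[X * Y]/(emul X Y).
case: u => [|a u]; last first.
  by rewrite big1 // => c1 _; rewrite big1 // => d1 _; rewrite [in X in _ * X]lift_constE mulr0.
by rewrite emul_nil; apply: eq_bigr => c1 _; apply: eq_bigr => d1 _; rewrite !lift_constE.
Qed.

(** Constants cross [xs k] with the same signs as a letter; this is where the parity hypothesis
    enters. *)
Lemma lift_const_swap k X :
  lift_const X * xs k = xs k * lift_const (const_twist (lt k) X).
Proof.
rewrite /lift_const mulr_suml mulr_sumr; apply: eq_bigr => c _.
rewrite mulr_suml mulr_sumr; apply: eq_bigr => d _.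
by rewrite -scalerAl xs_par scalerA -scalerAr /const_twist mulrC.
Qed.

(** Both sides obey the same first-letter recursion, by the Leibniz rule and [lift_const_swap]. Each
    letter contributes one degree, so induction on the precision applies. *)
Lemma evM X Y : ev (X * Y) = ev X * ev Y.
Proof.
apply: eqmod_eq => N; elim: N X Y => // N IH X Y.
set dX := fun k => lderiv (lt k) X; set dY := fun k => lderiv (lt k) Y.
set X0 := fun k => const_twist (lt k) X.
have eXY : ev (X * Y) =
    lift_const X * lift_const Y + \sum_k xs k * (ev (X0 k * dY k) + ev (dX k * Y)).
  rewrite ev_rec lift_constM; congr (_ + _); apply: eq_bigr => k _.
  by rewrite [lderiv _ _]lderivM evD.
have eXeY : ev X * ev Y =
    lift_const X * lift_const Y + \sum_k xs k * (ev (X0 k) * ev (dY k) + ev (dX k) * ev Y).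
  rewrite {1}[ev X]ev_rec mulrDl {1}[ev Y]ev_rec mulrDr -addrA; congr (_ + _).
  rewrite mulr_sumr mulr_suml -big_split; apply: eq_bigr => k _ /=.
  rewrite mulrA lift_const_swap mulrDr !mulrA.
  by rewrite [ev (X0 k)]ev_const // => c d u; apply: const_twist_const.
rewrite eXY eXeY; apply: eqmodD; first exact: eqmod_refl.
apply: eqmod_sum => k _; apply: (@eqmodMl _ _ _ 1); first exact/infinitesimalE.
by apply: eqmodD; apply: IH.
Qed.

Lemma ev_ebasis c d : ev (@ebasis R 2 c d) = @ebasis R n c d.
Proof.
rewrite ev_const => [|c' d' u hu]; last by rewrite ebasis_const.
apply/eltP => c' d' u; rewrite lift_constE; case: u => [|a u]; last by rewrite ebasis_const.
by rewrite /ebasis.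
Qed.

End Hom.

(** * Split variables *)

Section Letters.
Variables (R : fieldType).

Fact split_index_subproof (j a b : bool) : (4 * j + 2 * a + b < 8)%N.
Proof. by case: j; case: a; case: b. Qed.
Definition split_index (j a b : bool) : 'I_8 := Ordinal (split_index_subproof j a b).

Definition letter_index m (l : letter m.+2) : 'I_8 :=
  split_index (0 < l.1.1)%N l.1.2 l.2.

Lemma val_gen m (j : bool) : gen m j = j :> nat.
Proof. by rewrite /gen inordK //; case: j. Qed.

Lemma split_indexK m j a b : split_letter m (split_index j a b) = (gen m j, a, b).
Proof. by case: j; case: a; case: b. Qed.

Lemma ord8P (P : 'I_8 -> Prop) :
  (forall j a b, P (split_index j a b)) -> forall k, P k.
Proof.
move=> h k; have -> : k = split_index (3 < k)%N (odd (k %/ 2)) (odd k).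
  by apply/val_inj; case: k => [[|[|[|[|[|[|[|[|//]]]]]]]]].
exact: h.
Qed.

Lemma split_letterK m : cancel (split_letter m) (@letter_index m).
Proof.
apply: ord8P => j a b; rewrite split_indexK /letter_index /= val_gen.
by case: j.
Qed.

Lemma letter_indexK : cancel (@letter_index 0) (split_letter 0).
Proof.
move=> [[i a] b]; rewrite /letter_index split_indexK /=.
congr (_, _, _); apply/ord_inj; rewrite val_gen.
by case: i => [[|[|//]]].
Qed.

Lemma eletterMl n (a b : letter n) (x : elt R n) c d u :
  (eletter R a * x) c d (b :: u) = (a == b)%:R * (asgn R b c d * x c d u).
Proof.
rewrite -[eletter R a * x]/(emul _ _) emul_cons.
have -> : const_twist b (eletter R a) = 0.
  by apply/eltP => c' d' [|? ?] //=; rewrite /eletter /= !andbF mulr0.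
have -> : lderiv b (eletter R a) = (a == b)%:R *: 1.
  apply/eltP => c' d' w; rewrite /lderiv coefZ coef1 /eletter eqseq_cons (eq_sym b).
  case: eqP => _; last by rewrite !andbF mulr0 mul0r.
  by case: c'; case: d'; rewrite /= ?mulr0 // /asgn !andbF !mul1r; case: eqP.
rewrite -[emul 0 _]/(0 * lderiv b x) mul0r add0r.
by rewrite -[emul _ _]/(_ *: 1 * x) -scalerAl mul1r coefZ mulrCA.
Qed.

Lemma eletterMl_nil n (a : letter n) (x : elt R n) c d :
  (eletter R a * x) c d [::] = 0.
Proof.
have h : deg_ge 1 (eletter R a) by move=> c' d' [] // _; rewrite /eletter /= !andbF.
by apply: (@deg_geMr _ _ 1 _ x h).
Qed.

Lemma ev_letter n (xs : 'I_8 -> elt R n) k : (forall k, infinitesimal (xs k)) ->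
  ev xs (eletter R (split_letter 0 k)) = xs k.
Proof.
move=> xs_inf; rewrite (ev_rec xs_inf) (bigD1 k) //= big1 => [|i ne_ik].
  rewrite addr0 [X in X + _](_ : _ = 0) ?add0r.
    rewrite [lderiv _ _](_ : _ = @ebasis R 2 false false).
      by rewrite (ev_ebasis xs_inf) [LHS]mulr1.
    apply/eltP => c d u; rewrite /lderiv /eletter /ebasis eqseq_cons eqxx /=.
    by case: c; case: d; rewrite ?mulr0 // /asgn !andbF mul1r.
  rewrite /lift_const big1 // => c _; rewrite big1 // => d _.
  by rewrite /eletter !andbF scale0r.
rewrite [lderiv _ _](_ : _ = 0) ?ev0 ?mulr0 //.
apply/eltP => c d u; rewrite /lderiv /eletter eqseq_cons.
by rewrite (can_eq (@split_letterK 0)) (negbTE ne_ik) !andbF mulr0.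
Qed.

(** Left multiplication by a letter prepends it, so the value of a series at the free letters
    displays its coefficients. *)
Lemma seval_letters (f : series R) c d u :
  seval f (fun k => eletter R (split_letter 0 k)) c d u =
  if c || d then 0 else f (map (@letter_index 0) u).
Proof.
have xs_inf k : infinitesimal (eletter R (split_letter 0 k)).
  by move=> c' d'; rewrite /eletter !andbF.
elim: u f => [|a u IH] f; rewrite (seval_rec xs_inf) coefD coefZ coef1 coef_sum.
  rewrite big1 ?addr0 => [|i _]; last by rewrite eletterMl_nil.
  by case: c; case: d; rewrite /= ?mulr0 ?mulr1.
rewrite !andbF mulr0 add0r (bigD1 (letter_index a)) //= big1 => [|i ne_ia]; last first.
  by rewrite eletterMl -{1}[a]letter_indexK (can_eq (@split_letterK 0)) (negbTE ne_ia) mul0r.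
rewrite addr0 eletterMl letter_indexK eqxx mul1r IH.
by case: (boolP (c || d)) => [_|]; rewrite ?mulr0 // negb_or /asgn => /andP[/negbTE-> /negbTE->];
   rewrite !andbF mul1r.
Qed.

End Letters.

Section Split.
Variable R : realFieldType.

Lemma coef_ebasisMl n c0 d0 (x : elt R n) c d u :
  (@ebasis R n c0 d0 * x) c d u =
  csgn R c0 d0 (c0 (+) c) (d0 (+) d) * x (c0 (+) c) (d0 (+) d) u.
Proof. exact: ebasisMl. Qed.

Lemma coef_ebasisMr n c0 d0 (x : elt R n) c d u :
  (x * @ebasis R n c0 d0) c d u =
  csgn R (c (+) c0) (d (+) d0) c0 d0 * sgn R ((par1 u && c0) (+) (par2 u && d0))
   * x (c (+) c0) (d (+) d0) u.
Proof. exact: ebasisMr. Qed.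

Lemma ebasisM n c1 d1 c2 d2 : @ebasis R n c1 d1 * @ebasis R n c2 d2 =
  csgn R c1 d1 c2 d2 *: @ebasis R n (c1 (+) c2) (d1 (+) d2).
Proof.
apply/eltP => c d u; rewrite coef_ebasisMl coefZ /ebasis; case: (u == _).
  by case: c1; case: d1; case: c2; case: d2; case: c; case: d; rewrite /= ?mulr0.
by rewrite !andbF !mulr0.
Qed.

Lemma eQ1Q1 n : @eQ1 R n * @eQ1 R n = -1.
Proof. by rewrite ebasisM /= scaleN1r. Qed.

Lemma QjQj n j : @Qj R n j * @Qj R n j = -1.
Proof. by case: j; rewrite ebasisM /= scaleN1r. Qed.

(** Conjugation by [Q1] multiplies the term [Q1^c Q2^d u] by the sign of parity [d + par1 u], so
    splitting is a projection onto one parity. *)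
Lemma qsplit1E n b (X : elt R n) c d u :
  qsplit (@eQ1 R n) b X c d u = if d (+) par1 u == b then X c d u else 0.
Proof.
rewrite /qsplit /Qinv !elt_opsE coefZ coefD coefZ mulNr mulNr coefN coef_ebasisMr coef_ebasisMl.
rewrite /csgn /sgn !andbF !addbF.
by case: (par1 u); case: b; case: d; case: c => /=; field.
Qed.

Lemma qsplit2E n b (X : elt R n) c d u :
  qsplit (@eQ2 R n) b X c d u = if c (+) par2 u == b then X c d u else 0.
Proof.
rewrite /qsplit /Qinv !elt_opsE coefZ coefD coefZ mulNr mulNr coefN coef_ebasisMr coef_ebasisMl.
rewrite /csgn /sgn !andbF !addbF.
by case: (par2 u); case: b; case: d; case: c => /=; field.
Qed.

(** The relative displacement [(A - Q) Q^-1]; its parity components are the split variables. *)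
Definition offset n (A : elt R n) j : elt R n := (A - @Qj R n j) * - @Qj R n j.

Lemma offsetK n (A : elt R n) j : A = (1 + offset A j) * @Qj R n j.
Proof. by rewrite /offset mulrDl mul1r -mulrA mulNr QjQj opprK mulr1 addrC subrK. Qed.

Lemma splitvarsE n (A1 A2 : elt R n) j a b c d u :
  splitvars A1 A2 (split_index j a b) c d u =
  if (d (+) par1 u == a) && (c (+) par2 u == b)
  then offset (if j then A2 else A1) j c d u else 0.
Proof.
rewrite /splitvars qsplit2E qsplit1E.
have -> : (3 < split_index j a b)%N = j by case: j; case: a; case: b.
have -> : odd (split_index j a b %/ 2) = a by case: j; case: a; case: b.
have -> : odd (split_index j a b) = b by case: j; case: a; case: b.
by case: (d (+) _ == a); case: (c (+) _ == b).
Qed.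

Lemma infinitesimal_offset n (A : elt R n) j :
  infinitesimal (A - @Qj R n j) -> infinitesimal (offset A j).
Proof. by move=> /infinitesimalE h; apply/infinitesimalE/deg_geMr. Qed.

Section Pair.
Variables (n : nat) (A1 A2 : elt R n).
Hypotheses (A1_near : infinitesimal (A1 - @eQ1 R n)) (A2_near : infinitesimal (A2 - @eQ2 R n)).
Let xs := splitvars A1 A2.

Lemma splitvars_infinitesimal k : infinitesimal (xs k).
Proof.
move: k; apply: ord8P => j a b c d; rewrite /xs splitvarsE; case: ifP => // _.
by case: j; apply: infinitesimal_offset.
Qed.

(** All terms of a split variable have the same parities under conjugation by [Q1] and [Q2], namely
    those of the corresponding letter. *)
Lemma splitvars_parity k c d :
  @ebasis R n c d * xs k = asgn R (split_letter 0 k) c d *: (xs k * @ebasis R n c d).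
Proof.
move: k; apply: ord8P => j a b; apply/eltP => c' d' u.
rewrite coefZ coef_ebasisMl coef_ebasisMr /xs !splitvarsE split_indexK /asgn /csgn /=.
rewrite (addbC c' c) (addbC d' d); case: ifP => [/andP[/eqP<- /eqP<-]|_]; last by rewrite !mulr0.
rewrite !mulrA -!sgnD; congr (sgn _ _ * _).
by move: (par1 u) (par2 u); case: c; case: d; case: c'; case: d' => [] [] [].
Qed.

Definition sum_splits (j : bool) (F : 'I_8 -> elt R n) : elt R n :=
  F (split_index j false false) + F (split_index j false true) +
  (F (split_index j true false) + F (split_index j true true)).

Lemma sum_splitvars j : sum_splits j xs = offset (if j then A2 else A1) j.
Proof.
apply/eltP => c d u; rewrite /sum_splits !coefD /xs !splitvarsE.
by case: (d (+) par1 u); case: (c (+) par2 u); rewrite /= ?(addr0, add0r).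
Qed.

(** The four split components of an offset add up to it, so the homomorphism [ev] carries the
    generic pair to any nearby pair. *)
Lemma ev_Agen j : ev xs (@Agen R 0 j) = if j then A2 else A1.
Proof.
have inf := splitvars_infinitesimal; have par := splitvars_parity.
have evQ : ev xs (@Qj R 2 j) = @Qj R n j by case: j; apply: ev_ebasis.
rewrite /Agen /Rgen !elt_opsE evD (evM inf par) evQ !evD -!split_indexK !ev_letter //.
rewrite -/(sum_splits j xs) sum_splitvars -{1}[@Qj R n j]mul1r -mulrDl.
by rewrite -offsetK.
Qed.

End Pair.

Lemma Agen_offset m j : offset (@Agen R m j) j =
  eletter R (gen m j, false, false) + eletter R (gen m j, false, true) +
  (eletter R (gen m j, true, false) + eletter R (gen m j, true, true)).
Proof.
rewrite /offset /Agen /Rgen !elt_opsE addrAC subrr add0r -mulrA mulrN QjQj opprK.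
by rewrite mulr1.
Qed.

Lemma Agen_near m j : infinitesimal (@Agen R m j - @Qj R m.+2 j).
Proof.
rewrite /Agen /Rgen !elt_opsE addrAC subrr add0r; apply/infinitesimalE/deg_geMr.
by do ! apply: deg_geD; move=> c d [] // _; rewrite /eletter !andbF.
Qed.

Lemma splitvars_Agen m k :
  splitvars (@Agen R m false) (@Agen R m true) k = eletter R (split_letter m k).
Proof.
move: k; apply: ord8P => j a b; apply/eltP => c d u.
rewrite splitvarsE split_indexK.
have -> : (if j then @Agen R m true else @Agen R m false) = @Agen R m j by case: j.
rewrite Agen_offset !coefD /eletter.
case: c; case: d => /=; rewrite ?(addr0, if_same) //.
case: u => [|[[i a'] b'] [|l u]] /=; rewrite ?eqseq_cons ?andbF ?(addr0, if_same) //.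
rewrite !andbT !addbF -!pair_eqE /= -!pair_eqE /=.
by case: (i == _); case: a; case: b; case: a'; case: b'; rewrite /= ?(addr0, add0r).
Qed.

End Split.

(** * The invariant [T] *)

Section CliffordType.
Variables (R : fieldType) (n : nat).
Implicit Types (x y : elt R n).

Definition has_type (c0 d0 : bool) x :=
  forall c d u, (c, d) != (c0, d0) -> x c d u = 0.

Lemma has_typeD c d x y : has_type c d x -> has_type c d y -> has_type c d (x + y).
Proof. by move=> hx hy c' d' u h; rewrite coefD hx ?hy ?addr0. Qed.

Lemma has_typeN c d x : has_type c d x -> has_type c d (- x).
Proof. by move=> hx c' d' u h; rewrite coefN hx ?oppr0. Qed.

Lemma has_typeM c1 d1 c2 d2 x y : has_type c1 d1 x -> has_type c2 d2 y ->
  has_type (c1 (+) c2) (d1 (+) d2) (x * y).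
Proof.
move=> hx hy c d u ne; rewrite -[x * y]/(emul x y) /emul.
apply: big1 => i _; apply: big1 => c' _; apply: big1 => d' _ /=.
have [e|/hx->] := eqVneq (c', d') (c1, d1); last by rewrite mulr0 mul0r.
rewrite hy ?mulr0 //; move: e ne => [-> ->] {hx hy}.
by case: c; case: d; case: c1; case: d1; case: c2; case: d2.
Qed.

Lemma has_type_ebasis c d : has_type c d (@ebasis R n c d).
Proof.
move=> c' d' u; rewrite /ebasis xpair_eqE => /negbTE h.
by rewrite andbA h.
Qed.

Lemma has_type1 : has_type false false (1 : elt R n).
Proof. exact: has_type_ebasis. Qed.

Lemma has_typeX k x : has_type false false x -> has_type false false (x ^+ k).
Proof.
move=> hx; elim: k => [|k IH]; first exact: has_type1.
by rewrite exprS; apply: (has_typeM hx IH).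
Qed.

Lemma has_type_uinv x : has_type false false x -> has_type false false (uinv x).
Proof.
move=> hx c d u h; rewrite /uinv big1 // => k _; rewrite epowE.
by apply: has_typeX => //; apply: has_typeN.
Qed.

Lemma has_type_eletter (a : letter n) : has_type false false (eletter R a).
Proof. by move=> [] [] u // _; rewrite /eletter. Qed.

End CliffordType.

Section Tau.
Variable R : realFieldType.

(* The coefficients of [rtilde_4] (for [p = false]) and [rtilde_5] (for [p = true])
   in the split variables. *)
Definition tcoef (p : bool) (k : 'I_8) : R :=
  if odd (k %/ 2) == odd k then 2^-1 * sgn R ((3 < k)%N (+) (odd k && p)) else 0.

Lemma tcoefE p j a b :
  tcoef p (split_index j a b) = if a == b then 2^-1 * sgn R (j (+) (b && p)) else 0.
Proof. by case: j; case: a; case: b. Qed.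

Definition tau p : elt R 2 := \sum_k tcoef p k *: eletter R (split_letter 0 k).

Lemma tauMl p (x : elt R 2) c d a u :
  (tau p * x) c d (a :: u) = tcoef p (letter_index a) * (asgn R a c d * x c d u).
Proof.
rewrite /tau mulr_suml coef_sum (bigD1 (letter_index a)) //= big1 => [|i ne_ia].
  by rewrite addr0 -scalerAl coefZ eletterMl letter_indexK eqxx mul1r.
rewrite -scalerAl coefZ eletterMl -{1}[a]letter_indexK (can_eq (@split_letterK 0)).
by rewrite (negbTE ne_ia) mul0r mulr0.
Qed.

Lemma eletterMr n (a b : letter n) (x : elt R n) c d u :
  (x * eletter R a) c d (rcons u b) = (a == b)%:R * x c d u.
Proof.
rewrite -[x * _]/(emul _ _) /emul size_rcons big_ord_recr big_ord_recr /=.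
rewrite [X in _ + X]big1 ?addr0 => [|c1 _]; last first.
  by apply: big1 => d1 _; rewrite drop_oversize ?size_rcons // /eletter !andbF mulr0.
rewrite [X in X + _]big1 ?add0r => [|i _]; last first.
  apply: big1 => c1 _; apply: big1 => d1 _; rewrite /eletter.
  have -> : (drop i (rcons u b) == [:: a]) = false; last by rewrite !andbF mulr0.
  apply/eqP => /(congr1 size); rewrite size_drop size_rcons /=; have lti := ltn_ord i.
  by rewrite (subSn (ltnW lti)) => -[] /eqP; rewrite subn_eq0 leqNgt lti.
rewrite -cats1 take_size_cat // drop_size_cat // !big_bool /eletter /sgn.
rewrite eqseq_cons eqxx andbT (eq_sym b).
by case: (a == b); case: c; case: d; 
   rewrite /= ?andbF /= ?(mulr0, mul0r, addr0, add0r, mul1r, mulr1).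
Qed.

Lemma tauMr p (x : elt R 2) c d a u :
  (x * tau p) c d (rcons u a) = x c d u * tcoef p (letter_index a).
Proof.
rewrite /tau mulr_sumr coef_sum (bigD1 (letter_index a)) //= big1 => [|i ne_ia].
  by rewrite addr0 -scalerAr coefZ eletterMr letter_indexK eqxx mul1r mulrC.
rewrite -scalerAr coefZ eletterMr -{1}[a]letter_indexK (can_eq (@split_letterK 0)).
by rewrite (negbTE ne_ia) mul0r mulr0.
Qed.

Lemma deg_ge_eletter n (a : letter n) : deg_ge 1 (eletter R a).
Proof. by move=> c d [] // _; rewrite /eletter !andbF. Qed.

Lemma deg_ge_tau p : deg_ge 1 (tau p).
Proof. by apply: deg_ge_sum => k _; apply/deg_geZ/deg_ge_eletter. Qed.

Lemma ebasis_eletter k c d : @ebasis R 2 c d * eletter R (split_letter 0 k) =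
  asgn R (split_letter 0 k) c d *: (eletter R (split_letter 0 k) * @ebasis R 2 c d).
Proof. by rewrite -!splitvars_Agen; apply: splitvars_parity. Qed.

(** Conjugation by [Q1] or [Q2] exchanges [rtilde_4] and [rtilde_5], and conjugation by [Q1 Q2]
    fixes both. *)
Lemma ebasis_tau c d p : @ebasis R 2 c d * tau p = tau (p (+) c (+) d) * @ebasis R 2 c d.
Proof.
rewrite /tau mulr_sumr mulr_suml; apply: eq_bigr => k _.
rewrite -scalerAr ebasis_eletter scalerA -scalerAl; congr (_ *: _).
move: k; apply: ord8P => j a b; rewrite !tcoefE split_indexK /asgn /sgn.
by case: j; case: a; case: b; case: c; case: d; case: p;
   rewrite /=; ring.
Qed.

Lemma coef_tauX p k u : size u = k ->
  (tau p ^+ k) false false u = \prod_(a <- u) tcoef p (letter_index a).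
Proof.
elim: u k => [|a u IH] k <- /=; first by rewrite big_nil expr0 coef1.
by rewrite exprS tauMl big_cons IH // /asgn !andbF mul1r.
Qed.

End Tau.

(** * The generic pair and the leading terms of its invariant *)

Section NormalForm.
Variable R : realFieldType.
Local Notation Q1 := (@eQ1 R 2).
Local Notation Q12 := (@eQ12 R 2).

Definition A1 : elt R 2 := @Agen R 0 false.
Definition A2 : elt R 2 := @Agen R 0 true.
Definition Ainv : elt R 2 := - Q1 * uinv (offset A1 false).
Definition B : elt R 2 := A2 * Ainv.
Definition T : elt R 2 := 1 + B * B.

Lemma offset_Agen_inf j : infinitesimal (offset (@Agen R 0 j) j).
Proof. exact/infinitesimal_offset/Agen_near. Qed.

Lemma A1Ainv : A1 * Ainv = 1.
Proof.
rewrite /Ainv {1}(offsetK A1 false) -!mulrA [_ * (- Q1 * _)]mulrA mulrN eQ1Q1 opprK mul1r.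
exact/uinvr/offset_Agen_inf.
Qed.

Lemma AinvA1 : Ainv * A1 = 1.
Proof.
rewrite /Ainv {2}(offsetK A1 false) -!mulrA [uinv _ * (_ * _)]mulrA.
by rewrite (uinvl (offset_Agen_inf false)) mul1r mulNr eQ1Q1 opprK.
Qed.

Lemma has_type_Agen j : has_type (~~ j) j (@Agen R 0 j).
Proof.
have hQ : has_type (~~ j) j (@Qj R 2 j) by case: j; apply: has_type_ebasis.
apply: has_typeD => //; rewrite -[~~ j]addFb -[X in has_type _ X _]addFb.
apply: has_typeM => //.
by do ! apply: has_typeD; apply: has_type_eletter.
Qed.

Lemma has_type_Ainv : has_type true false Ainv.
Proof.
apply: (@has_typeM _ _ true false false false).
  exact/has_typeN/has_type_ebasis.
apply: has_type_uinv; rewrite /A1 Agen_offset.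
by do ! apply: has_typeD; apply: has_type_eletter.
Qed.

Lemma has_type_T : has_type false false T.
Proof.
have hB : has_type true true B := has_typeM (@has_type_Agen true) has_type_Ainv.
apply: has_typeD; first exact: has_type1.
exact: (has_typeM hB hB).
Qed.

Lemma Agen_eqmod1 j : eqmod 1 (@Agen R 0 j) (@Qj R 2 j).
Proof. exact/infinitesimalE/Agen_near. Qed.

Lemma Ainv_eqmod1 : eqmod 1 Ainv (- Q1).
Proof.
rewrite -[X in eqmod _ _ X]mulr1; apply: (@eqmodMl _ _ 1 0) => //.
exact/infinitesimalE/uinv_infinitesimal.
Qed.

(** Write [I = Q1 Q2], so [I^2 = -1], and [B = I + b] to first order. Then [1 + B^2] has linear part
    [I b + b I], in which only the letters of equal parities survive. *)
Lemma T_eqmod2 : eqmod 2 T (4 *: tau R false).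
Proof.
set x := offset A1 false; set y := offset A2 true; set b := y * Q12 - Q12 * x.
have x1 : deg_ge 1 x by apply/infinitesimalE/offset_Agen_inf.
have y1 : deg_ge 1 y by apply/infinitesimalE/offset_Agen_inf.
have b1 : deg_ge 1 b by apply: deg_geB; [exact: deg_geMr | exact: deg_geMl].
have II : Q12 * Q12 = -1 by rewrite ebasisM /= scaleN1r.
(* [B = (1 + y) I (1 + x)^-1] has linear part [y I - I x]. *)
have hB : eqmod 2 B (Q12 + b).
  have -> : B = (1 + y) * Q12 * uinv x.
    rewrite /B /Ainv {1}(offsetK A2 true) -!mulrA [_ * (- Q1 * _)]mulrA mulrN.
    by rewrite ebasisM scaleN1r opprK.
  apply: (eqmod_trans ((1 + y) * Q12 * (1 - x))).
    apply: (@eqmodMl _ _ 2 0) => //.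
    have := @uinv_eqmod _ _ 2 x (offset_Agen_inf false).
    by rewrite big_ord_recl big_ord1 expr0 expr1.
  have -> : (1 + y) * Q12 * (1 - x) = Q12 + b - y * Q12 * x.
    by rewrite mulrBr mulr1 !mulrDl mul1r /b opprD !addrA.
  rewrite /eqmod addrAC subrr add0r; apply/deg_geN/(@deg_geM _ _ 1 1) => //.
  exact: deg_geMr.
apply: (eqmod_trans (1 + (Q12 + b) * (Q12 + b))).
  by apply: eqmodD; [exact: eqmod_refl | exact: eqmodM].
have -> : 1 + (Q12 + b) * (Q12 + b) = Q12 * b + b * Q12 + b * b.
  by rewrite mulrDl !mulrDr II !addrA subrr add0r.
rewrite -[X in eqmod _ _ X]addr0; apply: eqmodD; last first.
  by rewrite /eqmod subr0; apply: (@deg_geM _ _ 1 1).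
suff -> : Q12 * b + b * Q12 = 4 *: tau R false by apply: eqmod_refl.
rewrite /b mulrBr mulrBl (mulrA Q12 y) (mulrA Q12 Q12) -(mulrA y) !II mulrN1 mulN1r opprK.
(* [I l I] is [- l] for a letter [l] of equal parities and [l] otherwise; in the second case it
   cancels against the unconjugated term. *)
have conj_letter j a c : Q12 * eletter R (gen 0 j, a, c) * Q12 =
    (- sgn R (a (+) c)) *: eletter R (gen 0 j, a, c).
  rewrite -split_indexK ebasis_eletter -scalerAl -mulrA II mulrN1 split_indexK.
  by rewrite /asgn /= !andbT scalerN scaleNr.
rewrite /x /y !Agen_offset !mulrDr !mulrDl !conj_letter.
have -> : tau R false =
   sum_splits false (fun k => tcoef R false k *: eletter R (split_letter 0 k))
   + sum_splits true (fun k => tcoef R false k *: eletter R (split_letter 0 k)).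
  rewrite /tau !big_ord_recl big_ord0 /sum_splits addr0 !addrA.
  by do ![congr (_ + _)]; congr (tcoef _ _ _ *: eletter _ (split_letter _ _)); apply/val_inj.
rewrite /sum_splits !tcoefE !split_indexK /sgn /=.
apply/eltP => c d u; rewrite !(coefD, coefN, coefZ).
by field.
Qed.

Lemma deg_ge_T : deg_ge 1 T.
Proof.
have := deg_geD (deg_geW (leqnSn 1) T_eqmod2) (deg_geZ 4 (@deg_ge_tau R false)).
by rewrite subrK.
Qed.

Lemma TX_eqmod k : eqmod k.+1 (T ^+ k) (4 ^+ k *: tau R false ^+ k).
Proof.
elim: k => [|k IH]; first by rewrite !expr0 scale1r; apply: eqmod_refl.
rewrite [T ^+ _]exprS; apply: (eqmod_trans (T * (4 ^+ k *: tau R false ^+ k))).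
  exact: (@eqmodMl _ _ k.+1 1 _ _ _ deg_ge_T IH).
have -> : 4 ^+ k.+1 *: tau R false ^+ k.+1 = (4 *: tau R false) * (4 ^+ k *: tau R false ^+ k).
  by rewrite -scalerAl -scalerAr scalerA -!exprS.
apply: (@eqmodMr _ _ 2 k); last exact: T_eqmod2.
by apply/deg_geZ; have := deg_geX (k := k) (@deg_ge_tau R false); rewrite muln1.
Qed.
End NormalForm.

(** * Variance *)

Section CovariantWord.
Variable K : pzRingType.
Implicit Types (a v t : K).

(** The expression [A1^-p T^k c A1^-s], with [v] standing for the inverse of [A1]. *)
Definition covariant_word (p s : bool) k (a2 c v : K) : K :=
  (if p then v else 1) * (1 + a2 * v * (a2 * v)) ^+ k * c * (if s then v else 1).

Lemma inverse_unique a v w : v * a = 1 -> a * w = 1 -> v = w.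
Proof. by move=> va aw; rewrite -[v]mulr1 -aw mulrA va mul1r. Qed.

(** The inverse [v] becomes [u2 v u1] and [a2 v] is conjugated by [t1]. Hence an outer factor [v]
    turns the left factor [t1] into [u2], or the right factor [t2] into [u1]. *)
Lemma covariant_word_twist p s k a1 a2 c v w t1 u1 t2 u2 :
  t1 * u1 = 1 -> u1 * t1 = 1 -> t2 * u2 = 1 -> a1 * v = 1 ->
  w * (t1 * a1 * t2) = 1 ->
  covariant_word p s k (t1 * a2 * t2) (t1 * c * t2) w =
  (if p then u2 else t1) * covariant_word p s k a2 c v * (if s then u1 else t2).
Proof.
move=> t1u1 u1t1 t2u2 a1v wa.
have {wa} -> : w = u2 * v * u1.
  apply: (inverse_unique wa); rewrite -!mulrA (mulrA t2) t2u2 mul1r (mulrA a1) a1v mul1r.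
  exact: t1u1.
rewrite /covariant_word.
have -> : t1 * a2 * t2 * (u2 * v * u1) = t1 * (a2 * v) * u1.
  by rewrite -!mulrA (mulrA t2) t2u2 mul1r.
set b := a2 * v.
have -> : (1 + t1 * b * u1 * (t1 * b * u1)) ^+ k = t1 * (1 + b * b) ^+ k * u1.
  have -> : 1 + t1 * b * u1 * (t1 * b * u1) = t1 * (1 + b * b) * u1.
    by rewrite mulrDr mulr1 mulrDl t1u1 -!mulrA (mulrA u1 t1) u1t1 mul1r.
  elim: k => [|k IH]; first by rewrite !expr0 mulr1 t1u1.
  by rewrite !exprS IH -!mulrA (mulrA u1 t1) u1t1 mul1r.
have K1 x : u1 * (t1 * x) = x by rewrite mulrA u1t1 mul1r.
have K2 x : t2 * (u2 * x) = x by rewrite mulrA t2u2 mul1r.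
by case: p; case: s; rewrite ?mul1r ?mulr1 -?mulrA ?K1 ?K2.
Qed.

Section Stabilizer.
Variables (a v t u : K).
Hypotheses (av : a * v = 1) (va : v * a = 1) (tu : t * u = 1) (ut : u * t = 1).

(** Used with [a = A1] and [t = 1 + T]: for [c = A1] or [A2] the product [c * v] is [1] or [B], and
    both commute with [t]. *)
Lemma stabilizer_fix c : t * (c * v) = c * v * t -> t * c * (v * u * a) = c.
Proof. by move=> tc; rewrite !mulrA -(mulrA t) tc -(mulrA (c * v)) tu mulr1 -mulrA va mulr1. Qed.

Lemma stabilizer_inv : v * u * a * (v * t * a) = 1.
Proof. by rewrite !mulrA -(mulrA (v * u)) av mulr1 -(mulrA v) ut mulr1 va. Qed.

(** The powers of [a] around [x] are chosen so that the left factor becomes [t] and the right one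
    [u], in every variance. *)
Lemma stabilizer_commute (p s : bool) x :
  x = (if p then v * t * a else t) * x * (if s then u else v * u * a) ->
  let y := (if p then a else 1) * x * (if s then 1 else v) in y * t = t * y.
Proof.
move=> ex /=; rewrite {1}ex.
have -> : (if p then a else 1) * ((if p then v * t * a else t) * x *
    (if s then u else v * u * a)) = t * ((if p then a else 1) * x) * (if s then u else v * u * a).
  by case: p {ex}; rewrite ?mul1r // !mulrA av mul1r.
rewrite -!mulrA; congr (_ * (_ * (_ * _))); case: s {ex}; rewrite ?mul1r //.
by rewrite -!mulrA (mulrA a) av mul1r ut mulr1.
Qed.
End Stabilizer.

End CovariantWord.

(** * All variances at once: covariant series and lowest-degree parts *)

Section Variant.
Variable R : realFieldType.

Section Cases.
(* [(p, s)] selects the variance: bivariant [(false, false)], antivariant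
   [(true, true)], left-variant [(false, true)], right-variant [(true, false)]. *)
Variables (p s j : bool).

Definition lfactor m (e1 e2 : elt R m.+2) := if p then uinv e2 else 1 + e1.
Definition rfactor m (e1 e2 : elt R m.+2) := if s then uinv e1 else 1 + e2.
(** For [p = s] this is [Q1] or [Q2], otherwise [1] or [Q1 Q2], according to [j]; up to sign it is
    the constant term of [A1^-p A_j A1^-s]. *)
Definition vtype n : elt R n := @ebasis R n (p (+) s (+) ~~ j) j.
Arguments vtype n : clear implicits.

Definition variant (f : series R) := forall m (e1 e2 : elt R m.+2),
  infinitesimal e1 -> infinitesimal e2 ->
  seval f (splitvars (twist e1 e2 (@Agen R m false)) (twist e1 e2 (@Agen R m true)))
    * vtype m.+2 =
  lfactor e1 e2 * (seval f (splitvars (@Agen R m false) (@Agen R m true)) * vtype m.+2)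
    * rfactor e1 e2.

Lemma variantD f g : variant f -> variant g -> variant (fun w => f w + g w).
Proof.
move=> hf hg m e1 e2 i1 i2.
by rewrite !sevalD !mulrDl mulrDr mulrDl hf // hg.
Qed.

Lemma variantZ k f : variant f -> variant (fun w => k * f w).
Proof.
move=> hf m e1 e2 i1 i2.
by rewrite !sevalZ -!scalerAl -scalerAr -scalerAl hf.
Qed.

(** Modulo degree [N] an evaluation depends only on the coefficients of words shorter than [N], so
    variance passes to limits. *)
Lemma variant_lim f :
  (forall N, exists2 g, variant g & forall w, (size w < N)%N -> f w = g w) -> variant f.
Proof.
move=> lim m e1 e2 i1 i2; apply: eqmod_eq => N; have [g hg fg] := lim N.
have h xs : eqmod N (seval f xs * vtype m.+2) (seval g xs * vtype m.+2).
  by rewrite -[N]addn0; apply: eqmodMr => //; apply: seval_eqmod.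
apply: (eqmod_trans _ (h _)); rewrite hg //; apply: eqmod_sym.
by do 2![apply: eqmodM; try exact: eqmod_refl].
Qed.

Lemma twist_near m (e1 e2 : elt R m.+2) i : infinitesimal e1 -> infinitesimal e2 ->
  infinitesimal (twist e1 e2 (@Agen R m i) - @Qj R m.+2 i).
Proof.
move=> /infinitesimalE i1 /infinitesimalE i2; apply/infinitesimalE.
rewrite -[X in _ - X]mulr1 -[X in _ - X * _]mul1r.
have h e : deg_ge 1 e -> @eqmod R m.+2 1 (1 + e) 1 by rewrite /eqmod addrAC subrr add0r.
apply: eqmodM; last exact: h.
by apply: eqmodM; [exact: h | apply/infinitesimalE/Agen_near].
Qed.

Definition Phi k : elt R 2 := covariant_word p s k (A2 R) (@Agen R 0 j) (Ainv R).
(** [Phi k] has a single Clifford component, so one series represents it. *)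
Definition phi k : series R := rseries (Phi k) (p (+) s (+) ~~ j) j.

Lemma has_type_Phi k : has_type (p (+) s (+) ~~ j) j (Phi k).
Proof.
have hV b : has_type b false (if b then Ainv R else 1).
  by case: b; [exact: has_type_Ainv | exact: has_type1].
have := has_typeM (has_typeM (has_typeM (hV p) (has_typeX k (@has_type_T R)))
  (@has_type_Agen R j)) (hV s).
by rewrite !addbF /= -addbA (addbC (~~ j)) addbA.
Qed.

End Cases.
Arguments vtype p s j n : clear implicits.

Lemma seval_rseries n (xs : 'I_8 -> elt R n) (X : elt R 2) c d : has_type c d X ->
  seval (rseries X c d) xs * @ebasis R n c d = ev xs X.
Proof.
move=> hX; rewrite /ev.
have h c' d' : (c', d') != (c, d) -> seval (rseries X c' d') xs * @ebasis R n c' d' = 0.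
  move=> ne; have -> : rseries X c' d' = fun w => 0 * rseries X c' d' w.
    by apply/funext => w; rewrite /rseries /rcoef hX // mulr0 mul0r.
  by rewrite sevalZ scale0r mul0r.
rewrite (bigD1 c) //= (bigD1 d) //= big1 => [|d' ne]; last by rewrite h // xpair_eqE eqxx.
rewrite addr0 big1 ?addr0 // => c' ne; rewrite big1 // => d' _.
by rewrite h // xpair_eqE negb_and ne.
Qed.

Section EvPhi.
Variables (n : nat) (a1 a2 : elt R n).
Hypotheses (a1_near : infinitesimal (a1 - @eQ1 R n)) (a2_near : infinitesimal (a2 - @eQ2 R n)).
Let xs := splitvars a1 a2.

Lemma ev_Ainvl : ev xs (Ainv R) * a1 = 1.
Proof.
have inf := splitvars_infinitesimal a1_near a2_near; have par := @splitvars_parity R n a1 a2.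
by rewrite -[X in _ * X](ev_Agen a1_near a2_near false) -(evM inf par) AinvA1 (ev_ebasis inf).
Qed.

Lemma ev_Ainvr : a1 * ev xs (Ainv R) = 1.
Proof.
have inf := splitvars_infinitesimal a1_near a2_near; have par := @splitvars_parity R n a1 a2.
by rewrite -[X in X * _](ev_Agen a1_near a2_near false) -(evM inf par) A1Ainv (ev_ebasis inf).
Qed.

Lemma ev_Phi p s j k :
  ev xs (Phi p s j k) = covariant_word p s k a2 (if j then a2 else a1) (ev xs (Ainv R)).
Proof.
have inf := splitvars_infinitesimal a1_near a2_near; have par := @splitvars_parity R n a1 a2.
have ev1 : ev xs 1 = 1 by apply: (ev_ebasis inf).
have evX X i : ev xs (X ^+ i) = ev xs X ^+ i.
  by elim: i => // i IH; rewrite !exprS (evM inf par) IH.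
have evif b : ev xs (if b then Ainv R else 1) = if b then ev xs (Ainv R) else 1.
  by case: b.
rewrite /Phi /covariant_word !(evM inf par) !evif evX evD ev1 !(evM inf par).
by rewrite (ev_Agen a1_near a2_near j) -[A2 R]/(@Agen R 0 true) (ev_Agen a1_near a2_near).
Qed.

End EvPhi.

(** By [ev_Phi] the same series gives the covariant word at both the generic and the twisted pair,
    where [covariant_word_twist] compares them. *)
Lemma variant_phi p s j k : variant p s j (phi p s j k).
Proof.
move=> m e1 e2 i1 i2; rewrite /vtype /phi !(seval_rseries _ (@has_type_Phi p s j k)).
have nt i := @twist_near m e1 e2 i i1 i2; have na i := @Agen_near R m i.
rewrite (ev_Phi (nt false) (nt true)) (ev_Phi (na false) (na true)).
have twE i : (if i then twist e1 e2 (@Agen R m true) else twist e1 e2 (@Agen R m false)) =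
    (1 + e1) * (if i then @Agen R m true else @Agen R m false) * (1 + e2) by case: i.
rewrite twE; apply: covariant_word_twist.
- exact: uinvr.
- exact: uinvl.
- exact: uinvr.
- exact: (ev_Ainvr (na false) (na true)).
- exact: (ev_Ainvl (nt false) (nt true)).
Qed.

Lemma ebasis_tauX c d p k :
  @ebasis R 2 c d * tau R p ^+ k = tau R (p (+) c (+) d) ^+ k * @ebasis R 2 c d.
Proof.
elim: k => [|k IH]; first by rewrite !expr0 mulr1 mul1r.
by rewrite !exprS mulrA ebasis_tau -mulrA IH mulrA.
Qed.

Lemma sgn_neq0 b : sgn R b != 0.
Proof. by case: b; rewrite /= ?oppr_eq0 oner_eq0. Qed.

Lemma deg_ge_tauX p k : deg_ge k (tau R p ^+ k).
Proof. by have := deg_geX (k := k) (@deg_ge_tau R p); rewrite muln1. Qed.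

(** To leading order [A1^-1] is [- Q1], [A_j] is [Q_j] and [T^k] is [(4 rtilde_4)^k]; moving the
    left [Q1] across it, if [p] holds, yields [rtilde_5]. *)
Lemma Phi_eqmod p s j k : exists2 kappa : R, kappa != 0 &
  eqmod k.+1 (Phi p s j k) (kappa *: (tau R p ^+ k * vtype p s j 2)).
Proof.
pose cV b : elt R 2 := sgn R b *: @ebasis R 2 b false.
have hV b : eqmod 1 (if b then Ainv R else 1) (cV b).
  case: b; last by rewrite /cV scale1r; apply: eqmod_refl.
  by rewrite /cV scaleN1r; apply: Ainv_eqmod1.
have QjE : @Qj R 2 j = @ebasis R 2 (~~ j) j by case: j.
(* The signs come from replacing [A1^-1] by [- Q1] on either side and from multiplying the three
   Clifford factors. *)
exists (4 ^+ k * (sgn R p * (sgn R s * (csgn R p false (~~ j) j * csgn R (p (+) ~~ j) j s false)))).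
  by rewrite !mulf_neq0 ?sgn_neq0 // expf_neq0 // pnatr_eq0.
set X := (X in eqmod _ _ X).
have -> : X = cV p * (4 ^+ k *: tau R false ^+ k) * @Qj R 2 j * cV s.
  rewrite /X /cV QjE -!(scalerAl, scalerAr) ebasis_tauX /= !addbF -!mulrA.
  rewrite (mulrA (ebasis _ _ _)) ebasisM -!scalerAl ebasisM -!scalerAr !scalerA.
  have -> : p (+) ~~ j (+) s = p (+) s (+) ~~ j by apply: addbAC.
  by rewrite !addFb addbF; congr (_ *: _); ring.
have TX : deg_ge k (T R ^+ k) by have := deg_geX (k := k) (@deg_ge_T R); rewrite muln1.
rewrite -[cV p * _ * _ * _]mulrA -[Phi _ _ _ _]mulrA.
apply: (eqmod_trans (cV p * (4 ^+ k *: tau R false ^+ k) *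
  (@Agen R 0 j * (if s then Ainv R else 1)))).
  rewrite -[k.+1]addn0; apply: eqmodMr => //.
  apply: (eqmod_trans (cV p * T R ^+ k)); first exact: (@eqmodMr _ _ 1 k).
  by apply: (@eqmodMl _ _ k.+1 0) => //; apply: TX_eqmod.
rewrite -[k.+1]addn1; apply: eqmodMl; last by apply: eqmodM => //; apply: Agen_eqmod1.
exact/deg_geMl/deg_geZ/deg_ge_tauX.
Qed.

Lemma phi_lead p s j k : exists2 kappa : R, kappa != 0 &
  (forall w, (size w < k)%N -> phi p s j k w = 0) /\
  (forall w, size w = k -> phi p s j k w = kappa * \prod_(i <- w) tcoef R p i).
Proof.
have [kappa k0 /eqmodP hP] := Phi_eqmod p s j k; exists kappa => //.
have h w : (size w <= k)%N ->
    phi p s j k w = kappa * (tau R p ^+ k) false false (map (split_letter 0) w).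
  move=> lew; rewrite /phi /rseries /rcoef hP ?size_map ?ltnS // coefZ coef_ebasisMr !addbb.
  rewrite [csgn _ _ _ _ _](_ : _ = 1) // mul1r mulrCA [sgn _ _ * (_ * _)]mulrA -sgnD.
  by rewrite addbb mul1r.
split=> w hw.
  by rewrite h ?(ltnW hw) // deg_ge_tauX ?mulr0 ?size_map.
rewrite h ?hw // coef_tauX ?size_map //; congr (_ * _).
by rewrite big_map; apply: eq_bigr => i _; rewrite split_letterK.
Qed.

(** A form of degree [k] in free variables that commutes with a nonzero linear form [t] is a
    multiple of [t^k]. *)
Lemma commuting_monomial (t : 'I_8 -> R) (f : series R) k i0 : t i0 != 0 ->
  (forall a w w' b, size w = k -> a :: w = rcons w' b -> t a * f w = f w' * t b) ->
  exists c, forall w, size w = k -> f w = c * \prod_(i <- w) t i.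
Proof.
move=> t0 comm; exists (f (nseq k i0) / t i0 ^+ k).
(* Each use of commutation trades the last letter [b], with factor [t b], for a letter [i0] in
   front, with factor [t i0]. *)
have h v i : (i + size v)%N = k ->
    f (nseq i i0 ++ v) * t i0 ^+ size v = f (nseq k i0) * \prod_(i <- v) t i.
  elim/last_ind: v i => [|v b IH] i.
    by rewrite addn0 big_nil cats0 => ->; rewrite expr0.
  rewrite size_rcons -addSnnS => hi.
  have := comm i0 (nseq i i0 ++ rcons v b) (nseq i.+1 i0 ++ v) b.
  rewrite size_cat size_nseq size_rcons -addSnnS => /(_ hi) hc.
  rewrite exprS mulrA (mulrC (f _)) hc -?rcons_cat //.
  by rewrite mulrAC IH // -cats1 big_cat big_seq1 mulrA.
move=> w hw; have := h w 0 hw; rewrite /= hw => e.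
by rewrite mulrAC -e mulfK // expf_neq0.
Qed.

Lemma deg_ge_ebasisMl n N c d (x : elt R n) : deg_ge N (@ebasis R n c d * x) -> deg_ge N x.
Proof.
move=> /(deg_geMl (@ebasis R n c d)); rewrite mulrA ebasisM !addbb -scalerAl.
move=> /(deg_geZ (csgn R c d c d)^-1); rewrite scalerA mulVf ?sgn_neq0 // scale1r.
by rewrite [_ * x]mul1r.
Qed.

Lemma deg_ge_ebasisMr n N c d (x : elt R n) : deg_ge N (x * @ebasis R n c d) -> deg_ge N x.
Proof.
move=> /(deg_geMr (@ebasis R n c d)); rewrite -mulrA ebasisM !addbb -scalerAr.
move=> /(deg_geZ (csgn R c d c d)^-1); rewrite scalerA mulVf ?sgn_neq0 // scale1r.
by rewrite [x * _]mulr1.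
Qed.

(** A nontrivial twist fixing the generic pair turns variance into commutation with [T]; its
    lowest-degree part is commutation with [tau R p]. *)
Lemma variant_lead p s j k f : variant p s j f ->
  (forall w, (size w < k)%N -> f w = 0) ->
  exists c, forall w, size w = k -> f w = c * \prod_(i <- w) tcoef R p i.
Proof.
move=> vf f0.
set xs := splitvars (@Agen R 0 false) (@Agen R 0 true).
set F := seval f xs.
have FE c d u : F c d u = if c || d then 0 else f (map (@letter_index 0) u).
  rewrite -seval_letters /F; congr (seval _ _ _ _ _).
  by apply/funext => i; apply: splitvars_Agen.
have Fk : deg_ge k F.
  by move=> c d u ltu; rewrite FE f0 ?size_map ?if_same.
have iT : infinitesimal (T R) by apply/infinitesimalE/deg_ge_T.
(* The partner of [1 + T] in the stabilizer of the generic pair. *)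
set t2 := Ainv R * uinv (T R) * A1 R.
have tu := uinvr iT; have ut := uinvl iT.
have i2 : infinitesimal (t2 - 1).
  apply/infinitesimalE; rewrite -[X in _ - X](AinvA1 R) -[X in _ - X * _]mulr1 -mulrBl -mulrBr.
  exact/deg_geMr/deg_geMl/infinitesimalE/uinv_infinitesimal.
have th2 : 1 + (t2 - 1) = t2 by rewrite addrC subrK.
have ut2 : uinv (t2 - 1) = Ainv R * (1 + T R) * A1 R.
  apply: (inverse_unique (uinvl i2)); rewrite th2.
  exact: (stabilizer_inv (A1Ainv R) (AinvA1 R) ut).
have tw i : twist (T R) (t2 - 1) (@Agen R 0 i) = @Agen R 0 i.
  rewrite /twist !elt_opsE th2; apply: (stabilizer_fix (AinvA1 R) tu).
  case: i; last by rewrite A1Ainv mulr1 mul1r.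
  by rewrite -/(A2 R) -/(B R) /T !mulrDr !mulrDl !mul1r !mulr1 (mulrA (B R) (B R) (B R)).
have := vf 0 (T R) (t2 - 1) iT i2; rewrite !tw -/xs -/F.
rewrite /lfactor /rfactor ut2 th2.
move=> /(stabilizer_commute (A1Ainv R) ut) /=.
set P := if p then _ else _; set S := if s then _ else _.
(* Commutation with [1 + T] is commutation with [T]. *)
rewrite mulrDr mulr1 mulrDl mul1r => /addrI comm.
set Y := P * _ * S in comm.
(* The constant terms of the outer factors [P] and [S]. *)
pose p0 := @ebasis R 2 p false; pose s0 := sgn R (~~ s) *: @ebasis R 2 (~~ s) false.
have hP : eqmod 1 P p0.
  by rewrite /P /p0; case: (p); [exact: Agen_eqmod1 | exact: eqmod_refl].
have hS : eqmod 1 S s0.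
  rewrite /S /s0; case: (s) => /=; first by rewrite scale1r; apply: eqmod_refl.
  by rewrite scaleN1r; apply: Ainv_eqmod1.
set X := F * vtype p s j 2 in Y comm.
have Xk : deg_ge k X by apply: deg_geMr.
have Y0k : deg_ge k (p0 * X * s0) by apply/deg_geMr/deg_geMl.
have hY : eqmod k.+1 Y (p0 * X * s0).
  apply: (eqmod_trans (p0 * X * S)).
    by rewrite -[k.+1]addn0; apply: eqmodMr => //; apply: (@eqmodMr _ _ 1 k).
  by rewrite -[k.+1]addn1; apply: eqmodMl => //; apply: deg_geMl.
pose tau0 := 4 *: tau R false.
(* [Y] starts in degree [k] and [T] in degree [1], so precision [k + 2] retains exactly the product
   of the leading terms. *)
have comm0 : eqmod k.+2 (p0 * X * s0 * tau0) (tau0 * (p0 * X * s0)).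
  apply: (eqmod_trans (Y * T R)).
    apply: (eqmod_trans (p0 * X * s0 * T R)); apply: eqmod_sym.
      by rewrite -[k.+2]addn2; apply: eqmodMl => //; apply: T_eqmod2.
    by rewrite -[k.+2]addn1; apply: eqmodMr => //; apply: deg_ge_T.
  rewrite comm; apply: (eqmod_trans (T R * (p0 * X * s0))).
    by apply: (@eqmodMl _ _ k.+1 1) => //; apply: deg_ge_T.
  by apply: (@eqmodMr _ _ 2 k) => //; apply: T_eqmod2.
(* The invertible Clifford factors are moved outwards and cancelled; passing [p0] turns [rtilde_4]
   into [tau R p]. *)
have : eqmod k.+2 (F * tau R p) (tau R p * F).
  pose kap : R := 4 * (sgn R (~~ s) * csgn R (p (+) s (+) ~~ j) j (~~ s) false).
  have kap0 : kap != 0 by rewrite !mulf_neq0 ?sgn_neq0 // pnatr_eq0.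
  pose e := @ebasis R 2 (p (+) s (+) ~~ j (+) ~~ s) j.
  have qs : vtype p s j 2 * s0 = (kap / 4) *: e.
    rewrite /vtype /s0 -scalerAr ebasisM scalerA addbF; congr (_ *: _).
    by rewrite /kap mulrAC mulfV ?mul1r // pnatr_eq0.
  have e1 : p0 * X * s0 * tau0 = kap *: (p0 * (F * tau R p) * e).
    rewrite /X -!mulrA (mulrA (vtype p s j 2)) qs /tau0 -!(scalerAl, scalerAr) scalerA.
    rewrite /e ebasis_tau !mulrA; congr (_ *: (_ * tau R _ * _)).
      by field.
    by case: (p); case: (s); case: (j).
  have e2 : tau0 * (p0 * X * s0) = kap *: (p0 * (tau R p * F) * e).
    rewrite /X -!mulrA qs /tau0 -!(scalerAl, scalerAr) scalerA.
    rewrite !mulrA {2}/p0 ebasis_tau addbF addbb; congr (_ *: _).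
    by rewrite /kap; field.
  move: comm0; rewrite e1 e2 /eqmod -scalerBr -mulrBl -mulrBr => /(deg_geZ kap^-1).
  rewrite scalerA mulVf // scale1r => /deg_ge_ebasisMr; exact: deg_ge_ebasisMl.
move=> /eqmodP hF.
have t0 : tcoef R p (split_index false false false) != 0.
  by rewrite tcoefE /= mulr1 invr_eq0 pnatr_eq0.
apply: (commuting_monomial t0) => a w w' b hw e.
have e' : map (split_letter 0) (a :: w) = rcons (map (split_letter 0) w') (split_letter 0 b).
  by rewrite e map_rcons.
have := hF false false (map (split_letter 0) (a :: w)).
rewrite {2}e' tauMr /= tauMl !FE /= !(mapK (@split_letterK 0)) !split_letterK size_map hw.
by rewrite /asgn !andbF mul1r => -> //.
Qed.
End Variant.

(** * Circular coefficients *)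

Section CircularBasis.
Variable R : realFieldType.

Definition circ_index (p : bool) : 'I_8 := if p then i5 else i4.

(** The rows are orthogonal of squared norm [1/2], so twice the transpose is the inverse. *)
Lemma hatM_unit : hatM R \in unitmx.
Proof.
suff h : hatM R *m (2 *: (hatM R)^T) = 1%:M by have [] := mulmx1_unit h.
apply/matrixP => i j; rewrite !mxE !big_ord_recl big_ord0 !mxE /=.
case: i => [[|[|[|[|[|[|[|[|//]]]]]]]] ?]; case: j => [[|[|[|[|[|[|[|[|//]]]]]]]] ?] /=; by field.
Qed.

Lemma circN_unit : circN R \in unitmx.
Proof.
suff h : circN R *m (\matrix_(i < 8, j < 8)
    (circN R i j / (if (i == i4) || (i == i5) then 2 else 1))) = 1%:M
  by have [] := mulmx1_unit h.
apply/matrixP => i j; rewrite !mxE !big_ord_recl big_ord0 !mxE /=.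
case: i => [[|[|[|[|[|[|[|[|//]]]]]]]] ?]; case: j => [[|[|[|[|[|[|[|[|//]]]]]]]] ?] /=; by field.
Qed.

Lemma tcoef_circ p k : tcoef R p k = (circN R *m hatM R) (circ_index p) k.
Proof.
rewrite !mxE !big_ord_recl big_ord0 !mxE /tcoef /circ_index /sgn.
by case: p; case: k => [[|[|[|[|[|[|[|[|//]]]]]]]] ?] /=; field.
Qed.

(** A diagonal entry of the change-of-basis matrix times its inverse: [tau R p] has coefficient [1]
    at its own circular variable. *)
Lemma tcoef_Lc p : \sum_a tcoef R p a * Lc R a (circ_index p) = 1.
Proof.
have u : circN R *m hatM R \in unitmx by rewrite unitmx_mul circN_unit hatM_unit.
have := congr1 (fun M : 'M[R]_8 => M (circ_index p) (circ_index p)) (mulmxV u).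
rewrite mxE [RHS]mxE eqxx mulr1n => <-; apply: eq_bigr => a _.
by rewrite tcoef_circ.
Qed.

End CircularBasis.

(** * The triangular system: coefficients against leading monomials *)

Section Triangular.
Variables (R : realFieldType) (i : 'I_8) (t : 'I_8 -> R).
Implicit Types (f g : series R).

Definition power_coef k f : R :=
  \sum_(w : k.-tuple 'I_8) f w * \prod_(a <- w) Lc R a i.

Lemma circ_coef_power k f : circ_coef f (nseq k i) = power_coef k f.
Proof.
have : {in nseq k i, forall x, x = i} by move=> x /nseqP[].
rewrite /circ_coef; move: (nseq k i) (size_nseq k i) => s <- hs.
apply: eq_bigr => w _; rewrite big_tuple; congr (_ * _).
by apply: eq_bigr => l _; rewrite [nth _ _ _]hs ?mem_nth.
Qed.

Lemma eq_power_coef k f g : (forall w, size w = k -> f w = g w) ->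
  power_coef k f = power_coef k g.
Proof. by move=> h; apply: eq_bigr => w _; rewrite h ?size_tuple. Qed.

Lemma power_coefD k f g :
  power_coef k (fun w => f w + g w) = power_coef k f + power_coef k g.
Proof. by rewrite -big_split; apply: eq_bigr => w _; rewrite mulrDl. Qed.

Lemma power_coefZ k (r : R) f : power_coef k (fun w => r * f w) = r * power_coef k f.
Proof. by rewrite mulr_sumr; apply: eq_bigr => w _; rewrite mulrA. Qed.

Hypothesis t_dual : \sum_a t a * Lc R a i = 1.

(** The sum over words factors into [k] pairings, each equal to [1] by [t_dual]. *)
Lemma power_coef_monomial k (r : R) f :
  (forall w, size w = k -> f w = r * \prod_(a <- w) t a) -> power_coef k f = r.
Proof.
move=> hf; rewrite (eq_power_coef hf) power_coefZ -[RHS]mulr1; congr (_ * _).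
rewrite /power_coef {hf}.
under eq_bigr do rewrite -big_split /=.
elim: k => [|k IH].
  by rewrite (sum_tuple0 (fun w => \prod_(a <- w) (t a * Lc R a i))) big_nil.
rewrite (sum_tuple_cons k (fun w => \prod_(a <- w) (t a * Lc R a i))) -[RHS]t_dual.
apply: eq_bigr => a _; under eq_bigr do rewrite big_cons.
by rewrite -mulr_sumr IH mulr1.
Qed.

Variables (V : series R -> Prop) (phi : nat -> series R) (c : nat -> R).
Hypotheses (VD : forall f g, V f -> V g -> V (fun w => f w + g w))
  (VZ : forall r f, V f -> V (fun w => r * f w))
  (Vlim : forall f,
    (forall N, exists2 g, V g & forall w, (size w < N)%N -> f w = g w) -> V f)
  (Vlead : forall k f, V f -> (forall w, (size w < k)%N -> f w = 0) ->
    exists r, forall w, size w = k -> f w = r * \prod_(a <- w) t a)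
  (Vphi : forall k, V (phi k))
  (phi_low : forall k, exists2 r : R, r != 0 &
    (forall w, (size w < k)%N -> phi k w = 0) /\
    (forall w, size w = k -> phi k w = r * \prod_(a <- w) t a)).

(** Once shorter words vanish, the degree [k] part is [r] times the monomial, and [r] is the
    vanishing power coefficient. *)
Lemma variant_eq0 f : V f -> (forall k, power_coef k f = 0) -> forall w, f w = 0.
Proof.
move=> Vf f0 w; have [k] := ubnP (size w).
elim: k w => // k IH w; rewrite ltnS leq_eqVlt => /orP[/eqP hw|]; last exact: IH.
have [r hr] := Vlead Vf IH; rewrite hr //.
by have := power_coef_monomial hr; rewrite f0 => <-; rewrite mul0r.
Qed.

(** Each stage adds the multiple of [phi N'] that corrects the coefficient of degree [N']; words
    shorter than [N'] are not disturbed. *)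
Fixpoint approx N : series R :=
  if N is N'.+1 then fun w => approx N' w +
    (c N' - power_coef N' (approx N')) / power_coef N' (phi N') * phi N' w
  else fun=> 0.

Lemma V_approx N : V (approx N).
Proof.
elim: N => [|N IH]; last by apply: VD => //; apply: VZ.
have -> : approx 0 = fun w => 0 * phi 0 w by apply/funext => w; rewrite mul0r.
exact: VZ.
Qed.

Lemma approx_stable N k w : (size w < N)%N -> approx (N + k) w = approx N w.
Proof.
move=> hw; elim: k => [|k IH]; first by rewrite addn0.
rewrite addnS /= IH; have [_ _ [low _]] := phi_low (N + k).
by rewrite low ?mulr0 ?addr0 // (leq_trans hw) ?leq_addr.
Qed.

Lemma exists_unique_variant :
  exists! f : series R, V f /\ (forall k, circ_coef f (nseq k i) = c k).
Proof.
(* The coefficient at [w] is final from stage [size w + 1] on. *)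
pose f : series R := fun w => approx (size w).+1 w.
have fE N w : (size w < N)%N -> f w = approx N w.
  by move=> hw; rewrite -(subnKC hw) approx_stable.
have Vf : V f by apply: Vlim => N; exists (approx N); [exact: V_approx | exact: fE].
have fc k : power_coef k f = c k.
  rewrite (@eq_power_coef k f (approx k.+1)) => [|w hw]; last by apply: fE; rewrite hw.
  have [r r0 [_ /power_coef_monomial hr]] := phi_low k.
  by rewrite /= power_coefD power_coefZ hr divfK // addrC subrK.
exists f; split=> [|g [Vg gc]]; first by split=> // k; rewrite circ_coef_power fc.
apply/funext => w; apply/eqP; rewrite -subr_eq0; apply/eqP.
rewrite -mulN1r; apply: (variant_eq0 (VD Vf (VZ (-1) Vg))) => k.
by rewrite power_coefD power_coefZ fc -circ_coef_power gc mulN1r subrr.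
Qed.

End Triangular.

(** * Assembly of the six cases *)

Lemma unique_existence (R : realFieldType) p s j (c : nat -> R) :
  exists! f : series R,
    variant p s j f /\ (forall k, circ_coef f (nseq k (circ_index p)) = c k).
Proof.
apply: (exists_unique_variant (tcoef_Lc R p) (phi := phi R p s j)) => [f g|r f|f|k f|k|k].
- exact: variantD.
- exact: variantZ.
- exact: variant_lim.
- exact: variant_lead.
- exact: variant_phi.
- exact: phi_lead.
Qed.

Lemma ex_unique_pair (S U : Type) (P : S -> Prop) (Q : U -> Prop) :
  (exists! x, P x) -> (exists! y, Q y) -> exists! z : S * U, P z.1 /\ Q z.2.
Proof.
move=> [x [Px ux]] [y [Qy uy]]; exists (x, y); split=> // -[x' y'] /= [/ux -> /uy ->].
by [].
Qed.

Lemma eq_ex_unique (S : Type) (P Q : S -> Prop) :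
  (forall x, P x <-> Q x) -> (exists! x, P x) -> exists! x, Q x.
Proof.
move=> PQ [x [/PQ Qx ux]]; exists x; split=> // y /PQ; exact: ux.
Qed.

Theorem mainTheorem4 (R : realFieldType) :
  (* (b) bivariant vectorial, coefficients tilde p^{[s]}_{4,...,4} *)
  (forall c1 c2 : nat -> R,
     exists! F : series R * series R,
       bivariant_vec F /\
       (forall k, circ_coef F.1 (nseq k i4) = c1 k /\ circ_coef F.2 (nseq k i4) = c2 k))
  /\
  (* (b') antivariant vectorial, coefficients tilde p^{[s]}_{5,...,5} *)
  (forall c1 c2 : nat -> R,
     exists! F : series R * series R,
       antivariant_vec F /\
       (forall k, circ_coef F.1 (nseq k i5) = c1 k /\ circ_coef F.2 (nseq k i5) = c2 k))
  /\
  (* (c) left-variant scalar / pseudoscalar, coefficients with index 4 *)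
  (forall c : nat -> R,
     exists! f : series R,
       leftvariant_scalar f /\ (forall k, circ_coef f (nseq k i4) = c k))
  /\
  (forall c : nat -> R,
     exists! f : series R,
       leftvariant_pseudo f /\ (forall k, circ_coef f (nseq k i4) = c k))
  /\
  (* (c') right-variant scalar / pseudoscalar, coefficients with index 5 *)
  (forall c : nat -> R,
     exists! f : series R,
       rightvariant_scalar f /\ (forall k, circ_coef f (nseq k i5) = c k))
  /\
  (forall c : nat -> R,
     exists! f : series R,
       rightvariant_pseudo f /\ (forall k, circ_coef f (nseq k i5) = c k)).
Proof.
(* The two components of a vectorial operation satisfy independent conditions, so the pair reduces
   to [j = false] and [j = true]. *)
have vec (rhs : forall m, elt R m.+2 -> elt R m.+2 -> elt R m.+2 -> elt R m.+2) p s :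
    (forall j f, variant p s j f <->
       variance_prop (fun m A1 A2 => emul (seval f (splitvars A1 A2)) (@Qj R m.+2 j)) rhs) ->
    forall c1 c2 : nat -> R, exists! F : series R * series R, vec_variant rhs F /\
      (forall k, circ_coef F.1 (nseq k (circ_index p)) = c1 k /\
                 circ_coef F.2 (nseq k (circ_index p)) = c2 k).
  move=> hv c1 c2.
  have := ex_unique_pair (unique_existence p s false c1) (unique_existence p s true c2).
  apply: eq_ex_unique => F; split=> [[[/hv v1 h1] [/hv v2 h2]]|[v h]].
    by split=> [[]|k].
  split; split=> [|k].
  - exact/hv/(v false).
  - by have [] := h k.
  - exact/hv/(v true).
  - by have [] := h k.
(* [q] is the identity for scalar operations and right multiplication by [Q1 Q2] for pseudoscalar
   ones. *)
have sca (q : forall m, elt R m.+2 -> elt R m.+2)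
    (rhs : forall m, elt R m.+2 -> elt R m.+2 -> elt R m.+2 -> elt R m.+2) p s j :
    (forall f, variant p s j f <->
       variance_prop (fun m A1 A2 => q m (seval f (splitvars A1 A2))) rhs) ->
    forall c : nat -> R, exists! f : series R,
      variance_prop (fun m A1 A2 => q m (seval f (splitvars A1 A2))) rhs /\
      (forall k, circ_coef f (nseq k (circ_index p)) = c k).
  move=> hv c; apply: eq_ex_unique (unique_existence p s j c) => f.
  by split=> -[/hv].
split; first by apply: (vec _ false false) => -[] f.
split; first by apply: (vec _ true true) => -[] f.
split; first apply: (sca (fun _ x => x) _ false true false) => f.
  (* In the scalar case [vtype] is [1] and has to be removed as a factor. *)
  by split=> h m e1 e2 i1 i2; have := h m e1 e2 i1 i2;
    rewrite /vtype /= ![_ * @ebasis R _ false false]mulr1.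
split; first by apply: (sca (fun _ x => emul x (@eQ12 R _)) _ false true true) => f.
split; first apply: (sca (fun _ x => x) _ true false false) => f.
  by split=> h m e1 e2 i1 i2; have := h m e1 e2 i1 i2;
    rewrite /vtype /= ![_ * @ebasis R _ false false]mulr1.
by apply: (sca (fun _ x => emul x (@eQ12 R _)) _ true false true) => f.
Qed.
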